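(* Let $f=e^{-u}\in\mathcal A_0$ and $1\le p\le q<\infty$. Then $$J(E_\infty f)\le J(E_qf)\le J(E_pf)\le J(E_1f).$$
   Context: For a convex $u$, $u^*(y)=\sup_x\{\langle x,y\rangle-u(x)\}$. $\mathcal L$: proper convex $u:\mathbb R^n\to\mathbb R\cup\{+\infty\}$ with $u(x)\to+\infty$ as $|x|\to\infty$; $\mathcal L_0=\{u\in\mathcal L:u\ge0,\ u^{**}=u,\ u(0)=0\}$; $\mathcal A_0=\{e^{-u}:u\in\mathcal L_0\}$ (integrable, support with nonempty interior). For $f=e^{-u}$: $h_f=u^*$; $J(f)=\int f\,dx$; $J(f^\diamond)=\int(nf+f\log f)\,dx$; $\mu(f,\cdot)=(\nabla u)_\sharp(f\,dx)$. For $1\le p<\infty$, $\overline\delta J_p(f,g)=\big[\frac{1}{J(f^\diamond)}\int(h_g/h_f)^ph_f\,d\mu(f,x)\big]^{1/p}$, and $\overline\delta J_\infty(f,g)=\max_x h_g(x)/h_f(x)$. Gaussians: $\gamma_\phi(x)=e^{-\|\phi x\|^2/2}$, $\phi\in GL(n)$. For $p\in[1,\infty]$, $E_pf$ denotes the unique Gaussian $\gamma_\phi$ maximizing $J(\gamma_\phi)$ subject to $\overline\delta J_p(f,\gamma_\phi)\le1$ (the $L_p$ John ellipsoid of $f$). *)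

(* Defs.v *)
From HB Require Import structures.
From mathcomp Require Import all_boot all_order all_algebra.
From mathcomp Require Import all_classical all_reals all_analysis.
Set Implicit Arguments. Unset Strict Implicit. Unset Printing Implicit Defensive.
Import Order.TTheory GRing.Theory Num.Theory.
Import numFieldNormedType.Exports.
Local Open Scope classical_set_scope.
Local Open Scope ring_scope.

Section LpJohn.
Variable R : realType.

Definition dotp n (x y : 'rV[R]_n) : R := \sum_(i < n) x 0 i * y 0 i.

Definition sqnorm n (x : 'rV[R]_n) : R := \sum_(i < n) x 0 i ^+ 2.

Definition vcons m (t : R) (y : 'rV[R]_m) : 'rV[R]_m.+1 :=
  \row_(i < m.+1) match unlift ord0 i with Some j => y 0 j | None => t end.

Local Open Scope ereal_scope.

(* Lebesgue integral over R^m, as the iterated integral w.r.t. the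
   one-dimensional Lebesgue measure (R^0 is a point). *)
Fixpoint int_Rn (m : nat) : ('rV[R]_m -> \bar R) -> \bar R :=
  match m with
  | 0%N => fun F => F 0%R
  | m'.+1 => fun F =>
      \int[@lebesgue_measure R]_t int_Rn (fun y => F (vcons t y))
  end.

Variable n : nat.
Implicit Types (u v : 'rV[R]_n -> \bar R).

Definition legendre u (y : 'rV[R]_n) : \bar R :=
  ereal_sup [set (dotp x y)%:E - u x | x in [set: 'rV[R]_n]].

Definition proper_efun u := (forall x, -oo < u x) /\ (exists x, u x < +oo).

Definition convex_efun u := forall (x y : 'rV[R]_n) (t : R), (0 <= t <= 1)%R ->
  u ((1 - t) *: x + t *: y)%R <= (1 - t)%:E * u x + t%:E * u y.

Definition coercive u :=
  forall M : R, exists r : R, forall x, (r < `|x|)%R -> M%:E < u x.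

Definition class_L u := proper_efun u /\ convex_efun u /\ coercive u.

Definition class_L0 u :=
  class_L u /\ (forall x, 0 <= u x) /\ legendre (legendre u) = u /\ u 0%R = 0.

Definition efun u (x : 'rV[R]_n) : \bar R := expeR (- u x).

Definition J u : \bar R := int_Rn (efun u).

Definition class_A0 u :=
  class_L0 u /\ J u < +oo /\
  interior (closure [set x | efun u x != 0]) !=set0.

(* J(f^diamond) = int (n f + f log f) dx, with log f = -u *)
Definition Jdiamond u : \bar R :=
  int_Rn (fun x => n%:R%:E * efun u x + efun u x * (- u x)).

(* gradient of u (of its real part; relevant on the interior of dom u) *)
Definition grad u (x : 'rV[R]_n) : 'rV[R]_n :=
  \row_(i < n) ('D_(delta_mx ord0 i) (fun y => fine (u y)) x).

Definition gauss_pot (phi : 'M[R]_n) (x : 'rV[R]_n) : \bar R :=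
  (sqnorm (x *m phi^T) / 2)%:E.

(* integrand (h_g/h_f)^p h_f, written as h_g^p * (h_f^(p-1))^-1 *)
Definition lp_integrand (p : R) u v (y : 'rV[R]_n) : \bar R :=
  poweR (legendre v y) p * (poweR (legendre u y) (p - 1))^-1.

(* overline{delta J}_p(f,g), for f = e^{-u}, g = e^{-v}; the integral against
   mu(f,.) = (grad u)_# (f dx) is written as an integral against f dx *)
Definition deltaJp (p : R) u v : \bar R :=
  poweR ((Jdiamond u)^-1 *
         int_Rn (fun x => lp_integrand p u v (grad u x) * efun u x)) p^-1.

Definition deltaJinf u v : \bar R :=
  ereal_sup [set legendre v y * (legendre u y)^-1 | y in [set: 'rV[R]_n]].

Definition is_LpJohn (p : R) u (phi : 'M[R]_n) :=
  phi \in unitmx /\ deltaJp p u (gauss_pot phi) <= 1 /\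
  forall psi : 'M[R]_n, psi \in unitmx -> deltaJp p u (gauss_pot psi) <= 1 ->
    J (gauss_pot psi) <= J (gauss_pot phi).

Definition is_LinfJohn u (phi : 'M[R]_n) :=
  phi \in unitmx /\ deltaJinf u (gauss_pot phi) <= 1 /\
  forall psi : 'M[R]_n, psi \in unitmx -> deltaJinf u (gauss_pot psi) <= 1 ->
    J (gauss_pot psi) <= J (gauss_pot phi).

End LpJohn.

(* Main.v *)
(* For a mass measure [h_f d mu(f,.)] of total mass at most J(f^diamond), Young's
   inequality [a^p b^(1-p) <= (p/q) a^q b^(1-q) + (1-p/q) b] applied to
   [a = h_g], [b = h_f] turns the constraint [deltaJ_q(f,g) <= 1] into
   [deltaJ_p(f,g) <= 1] for p <= q; likewise [deltaJ_infty(f,g) <= 1], which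
   means [h_g <= h_f], implies [deltaJ_q(f,g) <= 1]. The feasible Gaussians thus
   increase as the exponent decreases, and so do the maximal volumes.

   It remains to bound the mass, i.e. [int <x, grad u> e^-u <= n int e^-u], since
   [h_f (grad u) = <x, grad u> - u]. Integration by parts would bring in boundary
   terms, so compare with dilations instead: convexity gives
   [u((1+e)x) >= u(x) + e <x, grad u(x)>], hence
   [(1+e)^-n int e^-u <= int e^-u / (1 + e <x, grad u>)]; divide by e and let e
   tend to 0. Only almost every point needs to be smooth: on each coordinate line
   a convex function has countably many kinks, and where all the partial
   derivatives exist they already form a subgradient. *)
Require Import Defs.
From HB Require Import structures.
From mathcomp Require Import all_boot all_order all_algebra.
From mathcomp Require Import all_classical all_reals all_analysis.
From mathcomp Require Import measurable_realfun ring lra.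
Set Implicit Arguments. Unset Strict Implicit. Unset Printing Implicit Defensive.
Import Order.TTheory GRing.Theory Num.Theory.
Import numFieldNormedType.Exports.
Local Open Scope classical_set_scope.
Local Open Scope ring_scope.

(** * Lebesgue measure on row vectors *)

(** [borel_rV R m] has the same elements as ['rV[R]_m] but carries the sigma-algebra generated by
    the open sets; the type ascriptions below switch between the two. *)
Definition open_rV (R : realType) m : set (set 'rV[R]_m) := open.
Arguments open_rV : clear implicits.
Notation borel_rV R m := (g_sigma_algebraType (open_rV R m)).

(** * Borel sets and measurable maps of row vectors *)

Section BorelRowVectors.
Variable R : realType.

Lemma open_measurable_rV m (A : set 'rV[R]_m) :
  open A -> measurable (A : set (borel_rV R m)).
Proof. by move=> oA; apply: sub_sigma_algebra. Qed.

Lemma lower_semicontinuous_measurable_rV m (F : 'rV[R]_m -> \bar R) :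
  (forall c : R, open [set x | (c%:E < F x)%E]) ->
  measurable_fun setT (F : borel_rV R m -> \bar R).
Proof.
move=> oF.
apply: (measurability _ (ErealGenOInfty.measurableE R)) => //.
move=> _ [_ [r ->] <-]; rewrite setTI.
apply: open_measurable_rV; rewrite (_ : _ @^-1` _ = [set x | (r%:E < F x)%E])//.
by apply/seteqP; split => x /=; rewrite in_itv/= andbT.
Qed.

Lemma continuous_measurable_rV m (F : 'rV[R]_m -> R) :
  continuous F -> measurable_fun setT (F : borel_rV R m -> R).
Proof.
move=> cF; apply/measurable_EFinP; apply: lower_semicontinuous_measurable_rV => c.
rewrite (_ : [set _ | _] = F @^-1` [set y | c < y]).
  by apply: open_comp => [x _|]; [exact: cF|exact: open_gt].
by apply/seteqP; split => x /=; rewrite lte_fin.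
Qed.

Lemma measurable_coord m (j : 'I_m) :
  measurable_fun setT (fun x : borel_rV R m => (x : 'rV[R]_m) 0 j).
Proof. by apply: continuous_measurable_rV; exact: coord_continuous. Qed.

(** Cubes with rational centre and radius 1/(k+1) form a countable base. Membership of [x] is
    spelled out coordinatewise, so that measurability of a map can be read off its coordinates. *)
Lemma open_rV_rat_balls m (A : set 'rV[R]_m) : open A ->
  A = \bigcup_(z : 'rV[rat]_m * nat)
    [set x | ball (map_mx ratr z.1 : 'rV[R]_m) z.2.+1%:R^-1 `<=` A /\
             forall j, `|x 0 j - ratr (z.1 0 j)| < z.2.+1%:R^-1].
Proof.
move=> oA; apply/seteqP; split => x; last first.
  move=> [[z k] _ /=] [zA xz]; apply: zA; split; first by rewrite invr_gt0.
  by move=> i j; rewrite (ord1 i) mxE /ball/= distrC.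
move=> Ax; have /nbhs_ballP[e /= e0 eA] : nbhs x A by apply: open_nbhs_nbhs.
(* Twice the radius stays below [e], so a cube that contains [x] lies in the [e]-ball around [x]. *)
have [k ke] : exists k : nat, 2 * k.+1%:R^-1 < e.
  exists (Num.truncn (2 / e)).
  rewrite ltr_pdivrMr// mulrC -ltr_pdivrMr//.
  exact: truncnS_gt.
have k0 : 0 < k.+1%:R^-1 :> R by rewrite invr_gt0.
have /choice[q qP] : forall j, exists r : rat, `|x 0 j - ratr r| < k.+1%:R^-1.
  move=> j; have [] := @rat_in_itvoo R (x 0 j - k.+1%:R^-1) (x 0 j + k.+1%:R^-1).
    by rewrite ltrBlDr -addrA ltrDl addr_gt0.
  move=> r; rewrite in_itv/= => /andP[r1 r2]; exists r.
  by rewrite ltr_distlC r1 r2.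
exists (\row_j q j, k) => //=; split; last by move=> j; rewrite mxE.
move=> y [_ yz]; apply: eA; split=> // i j.
have := yz i j; rewrite (ord1 i) !mxE /ball/= => yq; have xq := qP j.
rewrite (_ : x 0 j - y 0 j = (x 0 j - ratr (q j)) + (ratr (q j) - y 0 j)); last by ring.
by rewrite (le_lt_trans (ler_normD _ _))// (lt_trans _ ke)// mulr2n mulrDl mul1r ltrD.
Qed.

Lemma measurable_fun_rV m d (T : measurableType d) (f : T -> borel_rV R m) :
  (forall j, measurable_fun setT (fun x => (f x : 'rV[R]_m) 0 j)) ->
  measurable_fun setT f.
Proof.
move=> mf; apply: (@measurability _ _ _ _ setT f (open_rV R m)) => [//|_ [A oA <-]].
rewrite setTI (open_rV_rat_balls oA) preimage_bigcup.
apply: countable_bigcupT_measurable => [|[z k]]; first exact: countableP.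
(* Whether the cube lies in [A] does not depend on the point: each piece is empty or the preimage of
   a box. *)
have [zA|zA] := pselect (ball (map_mx ratr z : 'rV[R]_m) k.+1%:R^-1 `<=` A); last first.
  rewrite (_ : _ @^-1` _ = set0)//.
  by apply/seteqP; split => x //= -[].
rewrite (_ : _ @^-1` _ = \bigcap_(j in [set: 'I_m])
    ((fun x => (f x : 'rV[R]_m) 0 j) @^-1` `](ratr (z 0 j) - k.+1%:R^-1), (ratr (z 0 j) + k.+1%:R^-1)[ )).
  apply: fin_bigcap_measurable => // j _.
  by rewrite -[X in measurable X]setTI; apply: mf.
apply/seteqP; split => x /=.
  move=> [_ xz] j _ /=; have := xz j.
  by rewrite in_itv/= ltr_distl.
by move=> xz; split => // j; have := xz j I; rewrite /= in_itv/= ltr_distl.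
Qed.

Definition behead_rV m (x : 'rV[R]_m.+1) : 'rV[R]_m := \row_j x 0 (lift ord0 j).

Lemma vcons0 m t (y : 'rV[R]_m) : vcons t y 0 ord0 = t.
Proof. by rewrite mxE unlift_none. Qed.

Lemma vconsS m t (y : 'rV[R]_m) j : vcons t y 0 (lift ord0 j) = y 0 j.
Proof. by rewrite mxE liftK. Qed.

Lemma behead_vcons m t (y : 'rV[R]_m) : behead_rV (vcons t y) = y.
Proof. by apply/rowP => j; rewrite mxE vconsS. Qed.

Definition vcons_pair m (z : R * 'rV[R]_m) : 'rV[R]_m.+1 := vcons z.1 z.2.

Lemma measurable_vcons m : measurable_fun setT
  (@vcons_pair m : measurableTypeR R * borel_rV R m -> borel_rV R m.+1).
Proof.
apply: measurable_fun_rV => i; case: (unliftP ord0 i) => [j|] ->.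
  under eq_fun do rewrite /vcons_pair vconsS.
  exact: (measurableT_comp (measurable_coord j) measurable_snd).
under eq_fun do rewrite /vcons_pair vcons0.
exact: measurable_fst.
Qed.

Lemma measurable_behead m :
  measurable_fun setT (@behead_rV m : borel_rV R m.+1 -> borel_rV R m).
Proof.
apply: measurable_fun_rV => j; under eq_fun do rewrite mxE.
exact: measurable_coord.
Qed.

End BorelRowVectors.

(** * Iterated product measure and Tonelli's theorem *)

Section LebesgueRowVectors.
Variable R : realType.
Local Open Scope ereal_scope.

Section vcons_measure.
Variables (m : nat) (mu : {sigma_finite_measure set (borel_rV R m) -> \bar R}).

Definition vcons_measure : set (borel_rV R m.+1) -> \bar R :=
  pushforward (@lebesgue_measure R \x mu)
    (@vcons_pair R m : measurableTypeR R * borel_rV R m -> borel_rV R m.+1).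

Let pushforward_vcons : {measure set (borel_rV R m.+1) -> \bar R} :=
  measure_function_pushforward__canonical__measure_function_Measure
    (@lebesgue_measure R \x mu) (@measurable_vcons R m).

HB.instance Definition _ := isMeasure.Build _ _ _ vcons_measure
  (measure0 pushforward_vcons) (measure_ge0 pushforward_vcons)
  (@measure_semi_sigma_additive _ _ _ pushforward_vcons).

Let vcons_measure_sigma_finite : sigma_finite setT vcons_measure.
Proof.
have /sigma_finiteP[F [TF ndF Foo]] := sigma_finiteT (@lebesgue_measure R).
have /sigma_finiteP[G [TG ndG Goo]] := sigma_finiteT mu.
pose split_rV (x : borel_rV R m.+1) : measurableTypeR R * borel_rV R m :=
  ((x : 'rV_m.+1) 0%R ord0, behead_rV x).
exists (fun n => split_rV @^-1` (F n `*` G n)) => [|n].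
  apply/seteqP; split => // x _.
  have : setT ((x : 'rV[R]_m.+1) 0%R ord0) by []; rewrite TF => -[i _ Fi].
  have : setT (behead_rV x) by []; rewrite TG => -[j _ Gj].
  (* Both exhausting sequences increase, so the larger index serves for head and tail. *)
  exists (maxn i j) => //; split => /=.
    by move: Fi; exact/subsetPset/ndF/leq_maxl.
  by move: Gj; exact/subsetPset/ndG/leq_maxr.
have [mF Fn] := Foo n; have [mG Gn] := Goo n; split.
  rewrite -[X in measurable X]setTI.
  apply: (_ : measurable_fun setT split_rV) => //; last exact: measurableX.
  by apply: measurable_fun_pair; [exact: measurable_coord|exact: measurable_behead].
rewrite /vcons_measure /pushforward (_ : _ @^-1` _ = F n `*` G n).
  rewrite [X in X < _](product_measure1E (@lebesgue_measure R) mu)//.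
  by rewrite lte_mul_pinfty// ge0_fin_numE.
by apply/seteqP; split => -[t y]; rewrite /split_rV /= vcons0 behead_vcons.
Qed.

HB.instance Definition _ :=
  Measure_isSigmaFinite.Build _ _ _ vcons_measure vcons_measure_sigma_finite.

End vcons_measure.

(** Lebesgue measure on R^m, by the same recursion as [int_Rn]: the first coordinate is split off at
    each stage, and R^0 carries the unit point mass. *)
Fixpoint leb_rV m : {sigma_finite_measure set (borel_rV R m) -> \bar R} :=
  match m with
  | 0%N => \d_(0%R : borel_rV R 0)
  | m'.+1 => vcons_measure (leb_rV m')
  end.

Section Tonelli.
Variables (m : nat) (F : borel_rV R m.+1 -> \bar R).
Hypotheses (mF : measurable_fun setT F) (F0 : forall x, 0 <= F x).

Let F' (z : measurableTypeR R * borel_rV R m) := F (vcons z.1 z.2).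

Let mF' : measurable_fun setT F'.
Proof. exact: measurableT_comp mF (@measurable_vcons R m). Qed.

Let F'0 z : 0 <= F' z.
Proof. exact: F0. Qed.

Lemma ge0_integral_leb_rVS : \int[leb_rV m.+1]_x F x =
  \int[lebesgue_measure]_t \int[leb_rV m]_y F (vcons t y).
Proof.
rewrite /= /vcons_measure (ge0_integral_pushforward (@measurable_vcons R m))//.
by rewrite preimage_setT (fubini_tonelli1 F').
Qed.

(** The order with the first coordinate innermost serves for null sets described along lines in the
    first direction. *)
Lemma ge0_integral_leb_rVS_swap : \int[leb_rV m.+1]_x F x =
  \int[leb_rV m]_y \int[lebesgue_measure]_t F (vcons t y).
Proof. by rewrite ge0_integral_leb_rVS (fubini_tonelli F'). Qed.

Lemma measurable_int_vcons :
  measurable_fun setT (fun t : measurableTypeR R => \int[leb_rV m]_y F (vcons t y)).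
Proof. exact: (measurable_fun_fubini_tonelli_F F'). Qed.

End Tonelli.

Lemma measurable_vcons_l m (y : 'rV[R]_m) :
  measurable_fun setT (fun t : measurableTypeR R => vcons t y : borel_rV R m.+1).
Proof.
exact: (measurableT_comp (@measurable_vcons R m) (pair2_measurable _)).
Qed.

Lemma measurable_vcons_r m (t : R) :
  measurable_fun setT (fun y : borel_rV R m => vcons t y : borel_rV R m.+1).
Proof.
exact: (measurableT_comp (@measurable_vcons R m) (pair1_measurable _)).
Qed.

(* Mathcomp's integral of an arbitrary nonnegative function is the supremum
   over simple minorants, so it ignores null sets without any measurability
   assumption on the integrands. *)
Section integral_off_null.
Import HBNNSimple.
Context d (T : measurableType d) (mu : {measure set T -> \bar R}).
Variables (N : set T) (mN : measurable N) (N0 : mu N = 0).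

Let le_integral_off_null (f g : T -> \bar R) :
  (forall x, 0 <= f x) -> (forall x, 0 <= g x) ->
  (forall x, ~ N x -> f x = g x) -> \int[mu]_x f x <= \int[mu]_x g x.
Proof.
move=> f0 g0 fg; rewrite !ge0_integralTE//.
apply: ge_ereal_sup => _ [h hf <-].
have mNC : measurable (~` N) by exact: measurableC.
(* Setting a simple minorant [h] of [f] to zero on [N] keeps its integral and turns it into a
   minorant of [g]. *)
pose h' : {nnsfun T >-> R} := proj_nnsfun h mNC.
have h'E x : h' x = (h x * \1_(~` N) x)%R by [].
have -> : sintegral mu h = sintegral mu h'.
  transitivity (\int[mu]_x (h x)%:E).
    by rewrite integral_nnsfun// patch_setT.
  transitivity (\int[mu]_x (h' x)%:E); last first.
    by rewrite integral_nnsfun// patch_setT.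
  have mh (k : {nnsfun T >-> R}) : measurable_fun setT (fun x => (k x)%:E).
    exact/measurable_EFinP.
  have h0 (k : {nnsfun T >-> R}) x : setT x -> 0 <= (k x)%:E.
    by rewrite lee_fin.
  rewrite (ge0_negligible_integral mN measurableT (mh h) (h0 h) N0).
  rewrite [RHS](ge0_negligible_integral mN measurableT (mh h') (h0 h') N0).
  apply: eq_integral => x; rewrite inE => -[_ Nx].
  by rewrite h'E indicE mem_set// mulr1.
apply: ereal_sup_ubound; exists h' => // x; rewrite h'E indicE.
have [Nx|Nx] := pselect (N x).
  by rewrite memNset ?mulr0 ?g0//; exact.
by rewrite mem_set// mulr1 -fg.
Qed.

Lemma eq_integral_off_null (f g : T -> \bar R) :
  (forall x, ~ N x -> f x = g x) -> \int[mu]_x f x = \int[mu]_x g x.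
Proof.
move=> fg; rewrite [LHS]integralE [RHS]integralE.
have fgp x : ~ N x -> f^\+ x = g^\+ x by move=> /fg; rewrite !funeposE => ->.
have fgn x : ~ N x -> f^\- x = g^\- x by move=> /fg; rewrite !funenegE => ->.
by congr (_ - _); apply/eqP; rewrite eq_le; apply/andP; split;
  apply: le_integral_off_null => //= x Nx; rewrite ?fgp ?fgn.
Qed.

End integral_off_null.

End LebesgueRowVectors.

(** * Iterated integrals *)

Section IteratedIntegral.
Variable R : realType.
Local Open Scope ereal_scope.
Local Notation leb := (@lebesgue_measure R).

Lemma aeS d (T : semiRingOfSetsType d) (mu : set T -> \bar R) (P Q : set T) :
  P `<=` Q -> (\forall x \ae mu, P x) -> \forall x \ae mu, Q x.
Proof.
by move=> PQ [N [mN N0 PN]]; exists N; split => // x nQ; apply: PN => /PQ.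
Qed.

Lemma ae_eq_integralT d (T : measurableType d) (mu : {measure set T -> \bar R})
  (f g : T -> \bar R) :
  (\forall x \ae mu, f x = g x) -> \int[mu]_x f x = \int[mu]_x g x.
Proof.
move=> [N [mN N0 fgN]]; apply: (eq_integral_off_null mN N0) => x Nx.
by apply: contrapT => fgx; apply: Nx; exact: fgN.
Qed.

(** By Tonelli the measure of [N] is the integral of the measures of its slices, and a nonnegative
    integral vanishes exactly when its integrand does almost everywhere. *)
Lemma leb_rVS_null m (N : set (borel_rV R m.+1)) : measurable N ->
  leb_rV R m.+1 N = 0 <->
  \forall t \ae leb, leb_rV R m ((fun y => vcons t y) @^-1` N) = 0.
Proof.
move=> mN; have mI : measurable_fun setT (EFin \o (\1_N : borel_rV R m.+1 -> R)).
  by apply/measurable_EFinP; exact: measurable_indic.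
have I0 x : 0 <= (\1_N x)%:E :> \bar R by rewrite lee_fin.
have sliceE t : \int[leb_rV R m]_y (\1_N (vcons t y))%:E =
    leb_rV R m ((fun y => vcons t y) @^-1` N).
  rewrite -[in RHS](setIT (_ @^-1` N)) -(integral_indic _ measurableT)//.
  by rewrite -[X in measurable X]setTI; exact: measurable_vcons_r.
have -> : leb_rV R m.+1 N =
    \int[leb]_t `|leb_rV R m ((fun y => vcons t y) @^-1` N)|.
  rewrite -[in LHS](setIT N) -(integral_indic _ measurableT)//.
  rewrite (ge0_integral_leb_rVS mI I0).
  by apply: eq_integral => t _; rewrite gee0_abs// sliceE.
rewrite ae_eq_integral_abs//; last first.
  have := measurable_int_vcons mI I0.
  by under eq_fun do rewrite sliceE.
by split; apply: aeS => t //= /(_ I).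
Qed.

Lemma ae_leb_rVS m (P : set 'rV[R]_m.+1) : (\forall x \ae leb_rV R m.+1, P x) ->
  \forall t \ae leb, \forall y \ae leb_rV R m, P (vcons t y).
Proof.
move=> [N [mN /(leb_rVS_null mN) N0 PN]]; apply: aeS N0 => t Nt.
exists ((fun y => vcons t y) @^-1` N); split => //.
  by rewrite -[X in measurable X]setTI; exact: measurable_vcons_r.
by move=> y /= Pty; exact: PN.
Qed.

Lemma ae_dirac_rV0 (P : set 'rV[R]_0) : (\forall x \ae leb_rV R 0, P x) -> P 0%R.
Proof.
move=> [N [mN + PN]]; rewrite /= diracE => N0; apply: contrapT => nP.
by move: N0; rewrite mem_set//=; [move=> [] /eqP; rewrite oner_eq0|exact: PN].
Qed.

(** [F] may fail to be measurable: in almost every slice it agrees with [G] almost everywhere, and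
    each one-dimensional integral ignores null sets. This allows [grad u] to be replaced by a Borel
    field. *)
Lemma int_Rn_ge0 m (F : 'rV[R]_m -> \bar R) (G : borel_rV R m -> \bar R) :
  measurable_fun setT G -> (forall x, 0 <= G x) ->
  (\forall x \ae leb_rV R m, F x = G x) ->
  int_Rn F = \int[leb_rV R m]_x G x.
Proof.
elim: m F G => [|m IH] F G mG G0 FG.
  by rewrite /= integral_dirac// diracT mul1e; exact: ae_dirac_rV0 FG.
rewrite ge0_integral_leb_rVS//; apply: ae_eq_integralT.
apply: aeS (ae_leb_rVS FG) => t Ft; apply: IH => //.
exact: measurableT_comp mG (@measurable_vcons_r _ _ _).
Qed.

(** Fubini for signed integrands, needed for [Jdiamond]. Slices are integrable only for almost every
    [t]; the exceptional ones do not affect the outer integral. *)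
Lemma int_Rn_integrable m (F : borel_rV R m -> \bar R) :
  (leb_rV R m).-integrable setT F -> int_Rn F = \int[leb_rV R m]_x F x.
Proof.
elim: m F => [|m IH] F iF; have mF := measurable_int _ iF.
  by rewrite /= integral_dirac// diracT mul1e.
pose F' (z : measurableTypeR R * borel_rV R m) := F (vcons z.1 z.2).
have mF' : measurable_fun setT F' by exact: measurableT_comp mF (@measurable_vcons R m).
have iF' : (leb \x leb_rV R m).-integrable setT F'.
  apply/integrable12ltyP => //; move/integrableP : iF => [_].
  rewrite (ge0_integral_leb_rVS (F := abse \o F))//; first exact: measurableT_comp.
  by move=> x; exact: abse_ge0.
transitivity (\int[leb \x leb_rV R m]_z F' z); last first.
  apply/esym.
  by apply: (integral_pushforward (@measurable_vcons R m) mF).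
rewrite -(integral12_prod_meas1 iF').
apply: ae_eq_integralT; apply: aeS (ae_integrable1 iF') => t iFt.
exact: IH.
Qed.

(** As [t] varies this runs through the line through [x] parallel to the [i]-th axis. *)
Definition upd_rV m (x : 'rV[R]_m) (i : 'I_m) (t : R) : 'rV[R]_m :=
  \row_j (if j == i then t else x 0%R j).

Lemma vcons_upd m t (y : 'rV[R]_m) j s :
  vcons t (upd_rV y j s) = upd_rV (vcons t y) (lift ord0 j) s.
Proof.
apply/rowP => k; case: (unliftP ord0 k) => [l|] ->; last first.
  by rewrite !mxE (negPf (neq_lift _ _)) unlift_none.
by rewrite vconsS !mxE (inj_eq lift_inj) liftK.
Qed.

Lemma upd_vcons0 m t (y : 'rV[R]_m) s : upd_rV (vcons t y) ord0 s = vcons s y.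
Proof.
apply/rowP => k; rewrite !mxE; case: (unliftP ord0 k) => [l|] ->.
  by rewrite eq_sym (negPf (neq_lift _ _)).
by rewrite eqxx.
Qed.

(** Directions other than the first are handled slice by slice through induction; for the first
    direction Tonelli is applied with that coordinate innermost. *)
Lemma leb_rV_null_lines m (i : 'I_m) (N : set (borel_rV R m)) : measurable N ->
  (forall x, leb [set t | N (upd_rV x i t)] = 0) -> leb_rV R m N = 0.
Proof.
elim: m i N => [[]//|m IH] i N mN.
case: (unliftP ord0 i) => [j|] -> N0.
  apply/leb_rVS_null => //; apply: aeW => t; apply: (IH j) => [|y].
    by rewrite -[X in measurable X]setTI; exact: measurable_vcons_r.
  rewrite -(N0 (vcons t y)); congr (leb _).
  by apply/seteqP; split => s /=; rewrite vcons_upd.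
have mI : measurable_fun setT (EFin \o (\1_N : borel_rV R m.+1 -> R)).
  by apply/measurable_EFinP; exact: measurable_indic.
have I0 x : 0 <= (\1_N x)%:E :> \bar R by rewrite lee_fin.
rewrite -(setIT N) -(integral_indic _ measurableT)//.
rewrite (ge0_integral_leb_rVS_swap mI I0) integral0_eq// => y _.
transitivity (leb ((fun t => vcons t y) @^-1` N)); last first.
  rewrite -(N0 (vcons 0%R y)); congr (leb _).
  by apply/seteqP; split => s /=; rewrite upd_vcons0.
rewrite -[in RHS](setIT (_ @^-1` N)) -(integral_indic _ measurableT)//.
by rewrite -[X in measurable X]setTI; exact: measurable_vcons_l.
Qed.

(** Multiplied by [c], the pushforward under dilation agrees with Lebesgue measure on half-open
    intervals, hence everywhere by uniqueness. *)
Lemma lebesgue_measure_scale (c : R) (A : set R) : (0 < c)%R -> measurable A ->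
  c%:E * leb (( *%R c) @^-1` A) = leb A.
Proof.
move=> c0 mA.
have mc : measurable_fun setT ( *%R c : measurableTypeR R -> measurableTypeR R).
  exact: measurable_funM.
pose nu : {measure set (measurableTypeR R) -> \bar R} :=
  mscale (NngNum (ltW c0))
    (measure_function_pushforward__canonical__measure_function_Measure leb mc).
apply/esym; rewrite (@lebesgue_measure_unique _ nu)//.
move=> _ [[a b] _ <-].
rewrite /nu /= /mscale /= /pushforward /=.
rewrite (_ : _ @^-1` _ = `](a / c)%R, (b / c)%R]%classic).
  rewrite lebesgue_measure_itv/= lte_fin.
  rewrite [in LHS]lebesgue_measure_itv/= lte_fin ltr_pM2r ?invr_gt0//.
  case: ifPn => _; rewrite ?mule0// -!EFinD -EFinM; congr (_%:E).
  by rewrite -mulrBl mulrC divfK// gt_eqF.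
apply/seteqP; split => x /=; rewrite !in_itv/= ltr_pdivrMr// ler_pdivlMr//.
all: by rewrite mulrC.
Qed.

Lemma ge0_integral_scale (c : R) (G : measurableTypeR R -> \bar R) : (0 < c)%R ->
  measurable_fun setT G -> (forall t, 0 <= G t) ->
  c%:E * \int[leb]_t G (c * t)%R = \int[leb]_t G t.
Proof.
move=> c0 mG G0.
have mc : measurable_fun setT ( *%R c : measurableTypeR R -> measurableTypeR R).
  exact: measurable_funM.
pose push := (measure_function_pushforward__canonical__measure_function_Measure leb mc).
pose nu : {measure set (measurableTypeR R) -> \bar R} :=
  mscale (NngNum (ltW c0)) push.
rewrite [RHS](eq_measure_integral nu); last first.
  by move=> A mA _; apply/esym; exact: (lebesgue_measure_scale c0 mA).
rewrite ge0_integral_mscale//; congr (_ * _).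
by rewrite [RHS](ge0_integral_pushforward mc)// preimage_setT.
Qed.

(** Each coordinate contributes one factor [c]. *)
Lemma ge0_integral_leb_rV_scale m (c : R) (G : borel_rV R m -> \bar R) : (0 < c)%R ->
  measurable_fun setT G -> (forall x, 0 <= G x) ->
  (c ^+ m)%:E * \int[leb_rV R m]_x G (c *: (x : 'rV[R]_m))%R = \int[leb_rV R m]_x G x.
Proof.
move=> c0; elim: m G => [|m IH] G mG G0.
  have mcG : measurable_fun setT (fun x : borel_rV R 0 => G (c *: (x : 'rV_0))%R).
    by rewrite (_ : (fun _ => _) = G)//; apply/funext => x; rewrite !thinmx0.
  rewrite expr0 mul1e /= !integral_dirac//.
  by rewrite scaler0.
have scale_vcons t (y : 'rV[R]_m) : (c *: vcons t y = vcons (c * t) (c *: y))%R.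
  by apply/rowP => k; rewrite !mxE; case: unliftP => // l _; rewrite mxE.
have mcG : measurable_fun setT (fun x : borel_rV R m.+1 => G (c *: (x : 'rV_m.+1))%R).
  apply: measurableT_comp mG _; apply: measurable_fun_rV => j.
  under eq_fun do rewrite mxE.
  by apply: measurable_funM => //; exact: measurable_coord.
rewrite (ge0_integral_leb_rVS mcG)// (ge0_integral_leb_rVS mG)//.
rewrite -[RHS](ge0_integral_scale c0 (measurable_int_vcons mG G0)); last first.
  by move=> t; exact: integral_ge0.
rewrite exprS EFinM -muleA; congr (_ * _).
rewrite -ge0_integralZl//; last 3 first.
- exact: (measurable_int_vcons mcG).
- by move=> t _; exact: integral_ge0.
- by rewrite lee_fin exprn_ge0// ltW.
apply: eq_integral => t _; under eq_integral do rewrite scale_vcons.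
rewrite (IH (fun y => G (vcons (c * t)%R y)))//.
exact: measurableT_comp mG (@measurable_vcons_r _ _ _).
Qed.

End IteratedIntegral.

(** * One-sided slopes of convex functions of one variable *)

Section OneSidedSlopes.
Variables (R : realType) (phi : R -> \bar R).
Local Open Scope ereal_scope.

(** For convex [phi] finite at [t], difference quotients are monotone in the step, so this infimum
    is the right derivative, and [slope_left] is the left one. Restricting to the steps 1/(k+1)
    keeps the family countable, hence the slopes measurable in the base point. *)
Definition slope_right (t : R) : \bar R := ereal_inf (range (fun k : nat =>
  (k.+1%:R)%:E * (phi (t + k.+1%:R^-1)%R - phi t))).

Definition slope_left (t : R) : \bar R := ereal_sup (range (fun k : nat =>
  (k.+1%:R)%:E * (phi t - phi (t - k.+1%:R^-1)%R))).

Hypothesis phi_gtNy : forall t, -oo < phi t.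
Hypothesis phi_convex : forall (s t l : R), (0 <= l <= 1)%R ->
  phi ((1 - l) * s + l * t)%R <= (1 - l)%:E * phi s + l%:E * phi t.

(** The three-slope inequality with denominators cleared; finiteness at the ends passes to the point
    between. *)
Lemma convex_between (a b c A C : R) : (a < b)%R -> (b < c)%R ->
  phi a = A%:E -> phi c = C%:E ->
  exists2 B, phi b = B%:E & ((c - a) * B <= (c - b) * A + (b - a) * C)%R.
Proof.
move=> ab bc pa pc; have ca : (0 < c - a)%R by lra.
pose l := ((b - a) / (c - a))%R.
have lca : (l * (c - a) = b - a)%R by rewrite /l divfK// gt_eqF.
have l01 : (0 <= l <= 1)%R.
  by rewrite /l divr_ge0 ?ler_pdivrMr ?mul1r/=; lra.
have := phi_convex a c l01; rewrite pa pc -!EFinM -EFinD.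
have -> : ((1 - l) * a + l * c = b)%R by rewrite -[RHS](subrK a) -lca; ring.
have := phi_gtNy b; case: (phi b) => // B _; rewrite lee_fin => Ble.
exists B => //.
have -> : ((c - b) * A + (b - a) * C = (c - a) * ((1 - l) * A + l * C))%R.
  rewrite mulrDr -lca (_ : c - b = (c - a) * (1 - l))%R; first ring.
  by rewrite mulrBr mulr1 [(_ * l)%R]mulrC lca; ring.
by rewrite ler_pM2l.
Qed.

Lemma exists_invS_le (e : R) : (0 < e)%R -> exists k : nat, (k.+1%:R^-1 <= e)%R.
Proof.
move=> e0; exists (Num.truncn e^-1).
by rewrite invf_ple ?posrE// ltW// truncnS_gt.
Qed.

Let invS_gt0 k : (0 < k.+1%:R^-1 :> R)%R. Proof. by rewrite invr_gt0. Qed.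

(** Some step 1/(k+1) is at most [t - s], and its quotient does not exceed that of the longer
    chord. *)
Lemma slope_right_le s t S T : (s < t)%R -> phi s = S%:E -> phi t = T%:E ->
  slope_right s <= ((T - S) / (t - s))%:E.
Proof.
move=> st ps pt; have ts : (0 < t - s)%R by lra.
have [k kle] := exists_invS_le ts; have k0 := invS_gt0 k.
apply: ge_ereal_inf; exists (k.+1%:R%:E * (phi (s + k.+1%:R^-1)%R - phi s)); first by exists k.
have [kts|kts] := eqVneq k.+1%:R^-1%R (t - s)%R.
  rewrite kts subrKC ps pt -EFinB -EFinM lee_fin -kts invrK.
  by rewrite mulrC.
have h1 : (s < s + k.+1%:R^-1)%R by rewrite ltrDl.
have h2 : (s + k.+1%:R^-1 < t)%R by rewrite addrC -ltrBrDr lt_neqAle kts.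
have [B pB Ble] := convex_between h1 h2 ps pt.
rewrite pB ps -EFinB -EFinM lee_fin ler_pdivlMr//.
rewrite -[leLHS]mulrA -ler_pdivlMl ?ltr0n//.
by move: Ble; move: k.+1%:R^-1%R => x; nra.
Qed.

Lemma slope_left_ge s t S T : (s < t)%R -> phi s = S%:E -> phi t = T%:E ->
  ((T - S) / (t - s))%:E <= slope_left t.
Proof.
move=> st ps pt; have ts : (0 < t - s)%R by lra.
have [k kle] := exists_invS_le ts; have k0 := invS_gt0 k.
apply: le_trans (ereal_sup_ubound _); last by exists k.
have [kts|kts] := eqVneq k.+1%:R^-1%R (t - s)%R.
  rewrite kts subKr ps pt -EFinB -EFinM lee_fin -kts invrK.
  by rewrite mulrC.
have h1 : (s < t - k.+1%:R^-1)%R by rewrite ltrBrDr addrC -ltrBrDr lt_neqAle kts.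
have h2 : (t - k.+1%:R^-1 < t)%R by rewrite ltrBlDr ltrDl.
have [B pB Ble] := convex_between h1 h2 ps pt.
rewrite pB pt -EFinB -EFinM lee_fin ler_pdivrMr//.
rewrite -[leRHS]mulrA -ler_pdivrMl ?ltr0n//.
by move: Ble; move: k.+1%:R^-1%R => x; nra.
Qed.

(** Every backward quotient is at most every forward one. An infinite neighbouring value makes the
    backward quotient [-oo] or the forward one [+oo]. *)
Lemma slope_left_le_right t T : phi t = T%:E -> slope_left t <= slope_right t.
Proof.
move=> pt; apply: ge_ereal_sup => _ [k _ <-]; apply: le_ereal_inf_tmp => _ [l _ <-].
have k0 := invS_gt0 k; have l0 := invS_gt0 l.
have := phi_gtNy (t - k.+1%:R^-1); have := phi_gtNy (t + l.+1%:R^-1).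
case pl : (phi (t + _)%R) => [L| |]// _; case pk : (phi (t - _)%R) => [K| |]// _; rewrite pt.
- rewrite -!EFinB -!EFinM lee_fin.
  have h1 : (t - k.+1%:R^-1 < t)%R by rewrite ltrBlDr ltrDl.
  have h2 : (t < t + l.+1%:R^-1)%R by rewrite ltrDl.
  have [B] := convex_between h1 h2 pk pl.
  rewrite pt => -[<-].
  rewrite [X in (X * T)%R](_ : _ = k.+1%:R^-1 + l.+1%:R^-1)%R; last by ring.
  rewrite [X in (X * K)%R](_ : _ = l.+1%:R^-1)%R; last by ring.
  rewrite [X in (X * L)%R](_ : _ = k.+1%:R^-1)%R; last by ring.
  set x := k.+1%:R^-1%R; set y := l.+1%:R^-1%R => H.
  rewrite -(invrK k.+1%:R)%R -(invrK l.+1%:R)%R -/x -/y.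
  by rewrite [leLHS]mulrC [leRHS]mulrC ler_pdivrMr// mulrAC ler_pdivlMr//; nra.
- by rewrite /= mulr_infty gtr0_sg ?ltr0n// mul1e leNye.
- by rewrite /= mulr_infty gtr0_sg ?ltr0n// mul1e leey.
- by rewrite /= mulr_infty gtr0_sg ?ltr0n// mul1e leNye.
Qed.

Lemma slopes_fin_num s t r S T U : (s < t)%R -> (t < r)%R ->
  phi s = S%:E -> phi t = T%:E -> phi r = U%:E ->
  slope_left t \is a fin_num /\ slope_right t \is a fin_num.
Proof.
move=> st tr ps pt pr; have lr := slope_left_le_right pt.
have ge := slope_left_ge st ps pt; have le := slope_right_le tr pt pr.
split; rewrite fin_numE -ltey -ltNye.
  rewrite (lt_le_trans _ ge) ?ltNyr//=.
  by rewrite (le_lt_trans lr)// (le_lt_trans le)// ltry.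
by rewrite (lt_le_trans _ (le_trans ge lr)) ?ltNyr// (le_lt_trans le) ?ltry.
Qed.

Lemma slope_right_le_left s t S T : (s < t)%R -> phi s = S%:E -> phi t = T%:E ->
  slope_right s <= slope_left t.
Proof.
by move=> st ps pt; rewrite (le_trans (slope_right_le st ps pt))// slope_left_ge.
Qed.

(** Bad points are kinks or one of at most two extreme points of the domain. At a kink there is a
    gap between the slopes; gaps at different kinks are disjoint, so a rational chosen in each gap
    gives an injection. *)
Lemma countable_nonsmooth : countable [set t | phi t < +oo /\
  ~ (slope_left t = slope_right t /\ slope_right t \is a fin_num)].
Proof.
have phi_fin t : phi t < +oo -> exists T, phi t = T%:E.
  by have := phi_gtNy t; case: (phi t) => // T _ _; exists T.
pose top := [set t | phi t < +oo /\ forall s, phi s < +oo -> (s <= t)%R].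
pose bot := [set t | phi t < +oo /\ forall s, phi s < +oo -> (t <= s)%R].
pose kink := [set t | [/\ phi t < +oo, slope_left t \is a fin_num,
  slope_right t \is a fin_num & slope_left t < slope_right t]].
have sub1 (A : set R) : (forall s t, A s -> A t -> s = t) -> countable A.
  move=> A1; have [[t At]|A0] := pselect (A !=set0).
    apply: (@sub_countable _ _ _ [set t]); last exact: countable1.
    by apply: subset_card_le => s As /=; exact: A1.
  rewrite (_ : A = set0) ?countable0//.
  by apply/seteqP; split => // t At; apply: A0; exists t.
have ckink : countable kink.
  have /choice[q qP] : forall t, exists r : rat, kink t ->
      slope_left t < (ratr r)%:E < slope_right t.
    move=> t; have [[pt lf rf lr]|nk] := pselect (kink t); last by exists 0%R.
    have [|r] := @rat_in_itvoo R (fine (slope_left t)) (fine (slope_right t)).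
      by rewrite fine_lt.
    rewrite in_itv/= => /andP[r1 r2]; exists r => _.
    by rewrite -(fineK lf) -(fineK rf) !lte_fin r1.
  apply/countable_injP; exists (pickle \o q) => s t.
  rewrite !inE => ks kt /= /(pcan_inj pickleK) qst.
  have q_lt a b : kink a -> kink b -> (a < b)%R -> q a <> q b.
    move=> ka kb ab qab; have /andP[_ qa] := qP _ ka.
    have /andP[+ _] := qP _ kb; rewrite -qab => /lt_trans /(_ qa).
    have [[/phi_fin[A pA] _ _ _] [/phi_fin[B pB] _ _ _]] := (ka, kb).
    by rewrite ltNge (slope_right_le_left ab pA pB).
  by have [/(q_lt _ _ ks kt)/(_ qst)|/(q_lt _ _ kt ks)/(_ (esym qst))|] := ltgtP s t.
pose F (n : nat) := match n with 0%N => kink | 1%N => top | _ => bot end.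
apply: (@sub_countable _ _ _ (\bigcup_n F n)); last first.
  apply: bigcup_countable => [|[|[|n]] _]; [exact: countableP|exact: ckink| |].
  - by apply: sub1 => s t [ps sM] [pt tM]; apply/eqP; rewrite eq_le sM// tM.
  - by apply: sub1 => s t [ps sM] [pt tM]; apply/eqP; rewrite eq_le sM// tM.
apply: subset_card_le => t [pt bad].
(* Unless [t] is an extreme point, [phi] is finite on both sides of it; then both slopes are finite,
   and badness can only mean that they differ. *)
have [tM|/existsNP[r /not_implyP[pr /negP]]] :=
  pselect (forall s, phi s < +oo -> (s <= t)%R); first by exists 1%N.
rewrite -ltNge => tr.
have [tm|/existsNP[s /not_implyP[ps /negP]]] :=
  pselect (forall s, phi s < +oo -> (t <= s)%R); first by exists 2%N.
rewrite -ltNge => st; suff kt : kink t by exists 0%N.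
have [[[S pS] [T pT]] [U pU]] := (phi_fin _ ps, phi_fin _ pt, phi_fin _ pr).
have [lf rf] := slopes_fin_num st tr pS pT pU.
have lr : slope_left t < slope_right t.
  by rewrite lt_neqAle (slope_left_le_right pT) andbT; apply/eqP => lr; apply: bad.
by split.
Qed.

(** On each side, one difference quotient within [e] of [d] bounds all shorter ones by convexity;
    the opposite bound holds because [d] is the extremal quotient. [delta] is the smaller of the two
    steps. *)
Lemma smooth_taylor t T d : phi t = T%:E ->
  slope_left t = d%:E -> slope_right t = d%:E ->
  forall e, (0 < e)%R -> exists2 delta, (0 < delta)%R & forall h, (`|h| <= delta)%R ->
    exists2 H, phi (t + h)%R = H%:E & (`|H - T - h * d| <= e * `|h|)%R.
Proof.
move=> pt lt rt e e0.
have [_ [k _ <-] kd] : exists2 y, range (fun k : nat =>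
    (k.+1%:R)%:E * (phi (t + k.+1%:R^-1)%R - phi t)) y & y < (d + e)%:E.
  by apply: ereal_inf_lt; rewrite -/(slope_right t) rt lte_fin ltrDl.
have [_ [l _ <-] ld] : exists2 y, range (fun k : nat =>
    (k.+1%:R)%:E * (phi t - phi (t - k.+1%:R^-1)%R)) y & (d - e)%:E < y.
  by apply: ereal_sup_gt; rewrite -/(slope_left t) lt lte_fin ltrBlDr ltrDl.
have k0 := invS_gt0 k; have l0 := invS_gt0 l.
have kN : (0 < k.+1%:R :> R)%R by rewrite ltr0n.
have lN : (0 < l.+1%:R :> R)%R by rewrite ltr0n.
have [K pk kK] : exists2 K, phi (t + k.+1%:R^-1)%R = K%:E &
    (k.+1%:R * (K - T) < d + e)%R.
  move: kd; rewrite pt; have := phi_gtNy (t + k.+1%:R^-1).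
  case: (phi (t + _)%R) => [K _|_|//]; first by rewrite -EFinB -EFinM lte_fin; exists K.
  by rewrite addye// gt0_muley.
have [L pl lL] : exists2 L, phi (t - l.+1%:R^-1)%R = L%:E &
    (d - e < l.+1%:R * (T - L))%R.
  move: ld; rewrite pt; have := phi_gtNy (t - l.+1%:R^-1).
  case: (phi (t - _)%R) => [L _|_|//]; first by rewrite -EFinB -EFinM lte_fin; exists L.
  by rewrite addeNy// gt0_muleNy.
have {}kK : (K - T < k.+1%:R^-1 * (d + e))%R by rewrite ltr_pdivlMl ?ltr0n.
have {}lL : (l.+1%:R^-1 * (d - e) < T - L)%R by rewrite ltr_pdivrMl ?ltr0n.
move: (k.+1%:R^-1)%R (l.+1%:R^-1)%R k0 l0 pk pl kK lL => x y x0 y0 px py xK yL.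
exists (Num.min x y) => [|h]; first by rewrite lt_min x0.
rewrite le_min => /andP[hx hy].
have [h0|h0|->] := ltgtP h 0%R; last first.
- by exists T; rewrite ?addr0// subrr mul0r subr0 normr0 mulr0.
- rewrite gtr0_norm// in hx hy *.
  have [H pH Hle] : exists2 H, phi (t + h)%R = H%:E & (x * (H - T) <= h * (K - T))%R.
    have [hx'|hx'] := eqVneq h x; first by exists K; rewrite ?hx'.
    have h1 : (t < t + h)%R by rewrite ltrDl.
    have h2 : (t + h < t + x)%R by rewrite ltrD2l lt_neqAle hx'.
    by have [H pH Hle] := convex_between h1 h2 pt px; exists H => //; nra.
  exists H => //.
  have := @slope_right_le t (t + h)%R T H _ pt pH; rewrite ltrDl => /(_ h0).
  rewrite rt lee_fin addrAC subrr add0r ler_pdivlMr// => dH.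
  have HT : (H - T <= h * (d + e))%R.
    by rewrite -(ler_pM2l x0) (le_trans Hle)// mulrCA ler_pM2l// ltW.
  by rewrite ler_norml; apply/andP; split; nra.
- rewrite ltr0_norm// in hx hy *.
  have [H pH Hle] : exists2 H, phi (t + h)%R = H%:E & (y * (H - T) <= - h * (L - T))%R.
    have [hy'|hy'] := eqVneq (- h)%R y; first by exists L; rewrite ?hy'// -py -hy' opprK.
    have h1 : (t + h < t)%R by rewrite gtrDl.
    have h2 : (t - y < t + h)%R by rewrite ltrD2l ltrNl lt_neqAle hy'.
    by have [H pH Hle] := convex_between h2 h1 py pt; exists H => //; nra.
  exists H => //.
  have := @slope_left_ge (t + h)%R t H T _ pH pt; rewrite gtrDl => /(_ h0).
  rewrite lt lee_fin opprD addrA subrr add0r ler_pdivrMr ?oppr_gt0// => dH.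
  have HT : (H - T <= - h * (e - d))%R.
    rewrite -(ler_pM2l y0) (le_trans Hle)// mulrCA ler_pM2l ?oppr_gt0//; lra.
  by rewrite ler_norml; apply/andP; split; nra.
Qed.

End OneSidedSlopes.

(** * Gradients of convex functions *)

Section ConvexGradient.
Variables (R : realType) (n : nat) (u : 'rV[R]_n -> \bar R).
Local Open Scope ereal_scope.

Definition coord_line (x : 'rV[R]_n) (i : 'I_n) (h : R) : \bar R :=
  u (x + h *: delta_mx ord0 i)%R.

(** For convex [u] finite at [x]: the [i]-th partial derivative exists and is finite. *)
Definition smooth_coord (i : 'I_n) (x : 'rV[R]_n) :=
  slope_left (coord_line x i) 0%R = slope_right (coord_line x i) 0%R /\
  slope_right (coord_line x i) 0%R \is a fin_num.

(* Everywhere defined Borel substitute for [grad u]; the two agree at the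
   points where u is finite and all partial derivatives exist. *)
Definition grad_right (x : 'rV[R]_n) : 'rV[R]_n :=
  \row_i fine (slope_right (coord_line x i) 0%R).

Hypothesis u_gtNy : forall x, -oo < u x.
Hypothesis u_convex : convex_efun u.

Lemma coord_line_gtNy x i t : -oo < coord_line x i t.
Proof. exact: u_gtNy. Qed.

Lemma coord_line_convex x i (s t l : R) : (0 <= l <= 1)%R ->
  coord_line x i ((1 - l) * s + l * t)%R <=
    (1 - l)%:E * coord_line x i s + l%:E * coord_line x i t.
Proof.
move=> l01; apply: le_trans (u_convex _ _ l01).
rewrite /coord_line (_ : (x + _)%R = ((1 - l) *: (x + s *: delta_mx ord0 i) +
  l *: (x + t *: delta_mx ord0 i))%R)//.
rewrite !scalerDr !scalerA addrACA -scalerDl subrK scale1r.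
by rewrite -scalerDl.
Qed.

Lemma convex_fin (x y : 'rV[R]_n) (X Y t : R) : (0 <= t <= 1)%R ->
  u x = X%:E -> u y = Y%:E ->
  exists2 Z, u ((1 - t) *: x + t *: y)%R = Z%:E & (Z <= (1 - t) * X + t * Y)%R.
Proof.
move=> t01 ux uy; have := u_convex x y t01; rewrite ux uy -!EFinM -EFinD.
have := u_gtNy ((1 - t) *: x + t *: y); case: (u _) => // Z _.
by rewrite lee_fin; exists Z.
Qed.

(** Jensen's inequality with equal weights. The induction step mixes the mean of the last m+1 points
    with the first point, which gets weight 1/(m+2). *)
Lemma convex_mean m (y : 'I_m.+1 -> 'rV[R]_n) (Y : 'I_m.+1 -> R) :
  (forall i, u (y i) = (Y i)%:E) ->
  exists2 Z, u (m.+1%:R^-1 *: \sum_i y i)%R = Z%:E & (Z <= m.+1%:R^-1 * \sum_i Y i)%R.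
Proof.
elim: m y Y => [|m IH] y Y yY.
  by exists (Y ord0); rewrite !big_ord1 invr1 ?scale1r ?mul1r.
have [Z uZ ZY] := IH (y \o lift ord0) (Y \o lift ord0) (fun i => yY (lift ord0 i)).
have m0 : (0 < m.+1%:R :> R)%R by rewrite ltr0n.
have m1 : (m.+2%:R = m.+1%:R + 1 :> R)%R by rewrite -natr1.
have t01 : (0 <= (m.+2%:R^-1 : R) <= 1)%R.
  by rewrite invr_ge0 ler0n invf_le1 ?ltr0n// ler1n.
have mE : ((1 - m.+2%:R^-1) * m.+1%:R^-1 = m.+2%:R^-1 :> R)%R.
  by rewrite m1; field; apply/andP; split; rewrite gt_eqF//; lra.
have [W uW WZ] := convex_fin t01 uZ (yY ord0).
exists W.
  rewrite big_ord_recl scalerDr addrC -uW scalerA mE; congr (u (_ + _)%R).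
apply: le_trans WZ _; rewrite big_ord_recl mulrDr [leRHS]addrC lerD2r.
by rewrite -{2}mE -mulrA ler_wpM2l// subr_ge0; case/andP: t01.
Qed.

Lemma grad_right_slopes i x : smooth_coord i x ->
  slope_left (coord_line x i) 0%R = (grad_right x 0%R i)%:E /\
  slope_right (coord_line x i) 0%R = (grad_right x 0%R i)%:E.
Proof. by move=> [-> xfin]; rewrite mxE fineK. Qed.

(** The expansion along each coordinate line keeps [u] finite near [x], so [fine] in [grad] loses
    nothing and the difference quotients converge to the common slope. *)
Lemma grad_smooth x : u x < +oo -> (forall i, smooth_coord i x) ->
  grad u x = grad_right x.
Proof.
move=> ux sx; have [U uU] : exists U, u x = U%:E.
  by have := u_gtNy x; case: (u x) ux => // U _ _; exists U.
apply/rowP => i; rewrite mxE; have [sl sr] := grad_right_slopes (sx i).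
apply: cvg_lim => //; apply/cvgrPdist_le => e e0.
have l0 : coord_line x i 0%R = U%:E by rewrite /coord_line scale0r addr0.
have [d d0 dP] := smooth_taylor (@coord_line_gtNy x i) (@coord_line_convex x i) l0 sl sr e0.
near=> h.
have h0 : h != 0%R by near: h; exact: nbhs_dnbhs_neq.
have [H] : exists2 H, coord_line x i (0 + h)%R = H%:E &
    (`|H - U - h * grad_right x 0 i| <= e * `|h|)%R.
  apply: dP; near: h; exact: dnbhs0_le.
rewrite add0r /coord_line => uH Hle.
rewrite /shift /= [(_ *: delta_mx _ _ + x)%R]addrC uH uU /=.
rewrite -(ler_pM2r (_ : 0 < `|h|)%R) ?normr_gt0// -normrM -normrN.
rewrite (_ : (- _)%R = (H - U - h * grad_right x 0 i)%R)//.
by rewrite mulrBl opprB /GRing.scale /= mulrAC mulVf// mul1r [(grad_right _ _ _ * h)%R]mulrC.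
Unshelve. all: by end_near. Qed.

End ConvexGradient.

(** * Partial derivatives of a convex function form a subgradient *)

Section Subgradient.
Variables (R : realType) (n : nat) (u : 'rV[R]_n.+1 -> \bar R).
Local Open Scope ereal_scope.
Hypothesis u_gtNy : forall x, -oo < u x.
Hypothesis u_convex : convex_efun u.

(** Averaging the expansions along the axes bounds [u] at x - tz from above by its linear part plus
    a small error. As [x] is the midpoint of x - tz and x + tz, this becomes a lower bound at x +
    tz, which convexity carries to x + z. *)
Lemma grad_right_subgradient x U z Z : u x = U%:E -> (forall i, smooth_coord u i x) ->
  u (x + z)%R = Z%:E -> (U + dotp z (grad_right u x) <= Z)%R.
Proof.
move=> uU sx uZ; apply/ler_addgt0Pr => e e0.
have aux (a b c r : R) : (a - b + c <= r)%R -> (a <= b - c + r)%R by lra.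
(* The total error will be [e' * S], at most [e]; adding 1 avoids division by zero when z = 0. *)
pose S := (\sum_i `|z 0 i|)%R; pose e' := (e / (S + 1))%R.
have S0 : (0 <= S)%R by apply: sumr_ge0.
have e'0 : (0 < e')%R by rewrite divr_gt0//; lra.
have e'S : (e' * S <= e)%R.
  by rewrite /e' mulrAC ler_pdivrMr ?ler_pM2l//; lra.
have /choice[delta dP] : forall i, exists d : R, (0 < d)%R /\ forall h, (`|h| <= d)%R ->
    exists2 H, u (x + h *: delta_mx ord0 i)%R = H%:E &
      (`|H - U - h * grad_right u x 0 i| <= e' * `|h|)%R.
  move=> i; have [sl sr] := grad_right_slopes (sx i).
  have l0 : coord_line u x i 0%R = U%:E by rewrite /coord_line scale0r addr0.
  have [d d0 dP] := smooth_taylor (coord_line_gtNy u_gtNy x i)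
    (coord_line_convex u_convex x i) l0 sl sr e'0.
  by exists d; split => // h /dP; rewrite add0r.
pose d := (\big[Num.min/1]_i delta i)%R.
have d0 : (0 < d)%R by apply: lt_bigmin => // i _; have [] := dP i.
have dd i : (d <= delta i)%R by exact: bigmin_le_cond.
pose N := (n.+1%:R : R); have N0 : (0 < N)%R by rewrite ltr0n.
have S1 : (0 < S + 1)%R by rewrite ltr_wpDl.
have NS : (0 < N * (S + 1))%R by exact: mulr_gt0.
(* Small enough that every axis displacement [N * t * z 0 i] is within [delta i]; the bound by 1
   makes [t] a convex weight. *)
pose t := (Num.min 1 (d / (N * (S + 1))))%R.
have t0 : (0 < t)%R by rewrite lt_min ltr01 divr_gt0.
have t1 : (t <= 1)%R by rewrite ge_min lexx.
have tz i : (`|- (N * t * z 0 i)| <= delta i)%R.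
  rewrite normrN normrM (gtr0_norm (mulr_gt0 N0 t0)).
  apply: le_trans (dd i); apply: (@le_trans _ _ (N * t * (S + 1)))%R.
    rewrite ler_pM2l ?mulr_gt0//.
    by rewrite /S (bigD1 i)//= -addrA lerDl addr_ge0// sumr_ge0.
  have : (t <= d / (N * (S + 1)))%R by rewrite ge_min lexx orbT.
  by rewrite ler_pdivlMr// mulrA [(t * N)%R]mulrC.
have /choice[H HP] : forall i, exists H : R,
    u (x + (- (N * t * z 0 i)) *: delta_mx ord0 i)%R = H%:E /\
    (H <= U - N * t * z 0 i * grad_right u x 0 i + e' * (N * t * `|z 0 i|))%R.
  move=> i; have [H uH Hle] := (dP i).2 _ (tz i); exists H; split => //.
  have -> : (N * t * `|z 0 i| = `|- (N * t * z 0 i)|)%R.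
    by rewrite normrN [RHS]normrM gtr0_norm// mulr_gt0.
  by move: Hle; rewrite ler_norml => /andP[_]; rewrite mulNr opprK; exact: aux.
have [W] := convex_mean u_gtNy u_convex (fun i => (HP i).1).
rewrite -/N.
(* The factor [N] in each displacement cancels the averaging weight. *)
have -> : (N^-1 *: \sum_i (x + (- (N * t * z 0 i)) *: delta_mx ord0 i) = x - t *: z)%R.
  rewrite big_split/= sumr_const card_ord scalerDr -scaler_nat scalerA mulVf ?scale1r ?gt_eqF//.
  rewrite [in RHS](row_sum_delta z) [in RHS]scaler_sumr -sumrN scaler_sumr; congr (_ + _)%R.
  apply: eq_bigr => i _; rewrite scalerA [in RHS]scalerA -[in RHS]scaleNr.
  rewrite (_ : (N^-1 * - (N * t * z 0 i))%R = (- (t * z 0 i))%R)//.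
  by rewrite mulrN mulrA mulrA mulVf ?mul1r// gt_eqF.
move=> uW WH.
have {}WH : (W <= U - t * dotp z (grad_right u x) + e' * t * S)%R.
  apply: le_trans WH _; rewrite mulrC ler_pdivrMr//.
  apply: le_trans (ler_sum _ (fun i _ => (HP i).2)) _.
  rewrite big_split sumrB sumr_const card_ord/= -mulr_natr -/N.
  rewrite (_ : \sum_i _ = N * (t * dotp z (grad_right u x)))%R; last first.
    rewrite /dotp !mulr_sumr; apply: eq_bigr => i _; ring.
  rewrite (_ : \sum_i _ = N * (e' * t * S))%R; last first.
    rewrite /S !mulr_sumr; apply: eq_bigr => i _; ring.
  by rewrite mulrDl mulrBl [(N * _)%R]mulrC [(N * (_ * S))%R]mulrC.
have t01 : (0 <= t <= 1)%R by rewrite ltW.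
have h01 : (0 <= (2^-1 : R) <= 1)%R by apply/andP; split; lra.
have [V] := convex_fin u_gtNy u_convex t01 uU uZ.
have -> : ((1 - t) *: x + t *: (x + z) = x + t *: z)%R.
  by rewrite scalerDr addrA -scalerDl subrK scale1r.
move=> uV VZ.
have [U'] := convex_fin u_gtNy u_convex h01 uW uV.
have -> : ((1 - 2^-1) *: (x - t *: z) + 2^-1 *: (x + t *: z) = x)%R.
  rewrite (_ : 1 - 2^-1 = 2^-1 :> R)%R; last by field.
  rewrite -scalerDr addrACA [(- _ + _)%R]addrC subrr addr0 scalerDr -scalerDl.
  by rewrite (_ : 2^-1 + 2^-1 = 1 :> R)%R ?scale1r//; field.
rewrite uU => -[<-] UVW.
rewrite -(ler_pM2l t0); have : (e' * S * t <= e * t)%R by rewrite ler_pM2r.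
move: (dotp _ _) WH VZ UVW => D; nra.
Qed.

End Subgradient.

Lemma ae_forall_fin (R : realType) d (T : measurableType d)
    (mu : {measure set T -> \bar R}) (I : finType) (P : I -> T -> Prop) :
  (forall i, \forall x \ae mu, P i x) -> \forall x \ae mu, forall i, P i x.
Proof. by move=> aeP; apply: filter_forall. Qed.

(** * Measurability of the gradient and smoothness almost everywhere *)

Section MeasurableGradient.
Variables (R : realType) (n : nat) (u : borel_rV R n -> \bar R).
Local Open Scope ereal_scope.
Hypothesis u_meas : measurable_fun setT u.

Lemma measurable_translate (v : 'rV[R]_n) :
  measurable_fun setT (fun x : borel_rV R n => u ((x : 'rV[R]_n) + v)%R).
Proof.
apply: measurableT_comp u_meas _; apply: measurable_fun_rV => j.
under eq_fun do rewrite mxE.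
by apply: measurable_funD => //; exact: measurable_coord.
Qed.

Lemma measurable_slope_right i :
  measurable_fun setT (fun x : borel_rV R n => slope_right (coord_line u x i) 0%R).
Proof.
pose q (k : nat) (x : borel_rV R n) := (k.+1%:R)%:E *
  (coord_line u x i (0 + k.+1%:R^-1)%R - coord_line u x i 0%R).
rewrite (_ : (fun _ => _) = (fun x => einfs (q ^~ x) 0%N)); last first.
  apply/funext => x; rewrite /einfs /sdrop /slope_right; congr ereal_inf.
  by apply/seteqP; split => _ [k _ <-]; exists k.
apply: measurable_fun_einfs => k.
apply: emeasurable_funM => //; apply: emeasurable_funB; exact: measurable_translate.
Qed.

Lemma measurable_slope_left i :
  measurable_fun setT (fun x : borel_rV R n => slope_left (coord_line u x i) 0%R).
Proof.
pose q (k : nat) (x : borel_rV R n) := (k.+1%:R)%:E *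
  (coord_line u x i 0%R - coord_line u x i (0 - k.+1%:R^-1)%R).
rewrite (_ : (fun _ => _) = (fun x => esups (q ^~ x) 0%N)); last first.
  apply/funext => x; rewrite /esups /sdrop /slope_left; congr ereal_sup.
  by apply/seteqP; split => _ [k _ <-]; exists k.
apply: measurable_fun_esups => k.
apply: emeasurable_funM => //; apply: emeasurable_funB; exact: measurable_translate.
Qed.

Lemma measurable_grad_right :
  measurable_fun setT (grad_right u : borel_rV R n -> borel_rV R n).
Proof.
apply: measurable_fun_rV => j; under eq_fun do rewrite mxE.
by apply: measurableT_comp => //; exact: measurable_slope_right.
Qed.

Lemma measurable_nonsmooth i :
  measurable [set x : borel_rV R n | u x < +oo /\ ~ smooth_coord u i x].
Proof.
have mr := measurable_slope_right i; have ml := measurable_slope_left i.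
rewrite (_ : [set _ | _] = [set x : borel_rV R n | u x < +oo] `&`
  ~` ([set x | slope_left (coord_line u x i) 0%R = slope_right (coord_line u x i) 0%R] `&`
      [set x | slope_right (coord_line u x i) 0%R \is a fin_num]))//.
apply: measurableI.
  by rewrite -[X in measurable X]setTI; exact: (emeasurable_fun_infty_o measurableT u_meas).
apply: measurableC; apply: measurableI.
  rewrite -[X in measurable X]setTI; exact: measurable_eqe.
by rewrite -[X in measurable X]setTI; exact: (emeasurable_fin_num measurableT mr).
Qed.

Hypothesis u_gtNy : forall x, -oo < u x.
Hypothesis u_convex : convex_efun u.

Lemma upd_rV_add (x : 'rV[R]_n) i (t h : R) :
  (upd_rV x i t + h *: delta_mx ord0 i)%R = upd_rV x i (t + h).
Proof.
apply/rowP => j; rewrite !mxE eqxx /=.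
by case: (eqVneq j i) => _; rewrite ?mulr1 ?mulr0 ?addr0.
Qed.

(** For each [i] the bad set meets every line parallel to the [i]-th axis in a countable set, so it
    is null; there are finitely many directions. *)
Lemma ae_smooth : \forall x \ae leb_rV R n, u x < +oo -> forall i, smooth_coord u i x.
Proof.
suff H i : \forall x \ae leb_rV R n, u x < +oo -> smooth_coord u i x.
  by have := ae_forall_fin H; apply: aeS => x sx ux i; exact: sx.
exists [set x : borel_rV R n | u x < +oo /\ ~ smooth_coord u i x]; split.
- exact: measurable_nonsmooth.
- apply: (leb_rV_null_lines (i := i)); first exact: measurable_nonsmooth.
  move=> x; pose phi t := u (upd_rV x i t).
  apply: countable_lebesgue_measure0.
  have phi_gtNy t : -oo < phi t by exact: u_gtNy.
  have phi_convex (s t l : R) : (0 <= l <= 1)%R ->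
      phi ((1 - l) * s + l * t)%R <= (1 - l)%:E * phi s + l%:E * phi t.
    move=> l01; apply: le_trans (u_convex _ _ l01); rewrite /phi.
    rewrite (_ : upd_rV _ _ _ = ((1 - l) *: upd_rV x i s + l *: upd_rV x i t)%R)//.
    apply/rowP => j; rewrite !mxE; case: ifP => // _.
    by rewrite -mulrDl subrK mul1r.
  have lineE t h : coord_line u (upd_rV x i t) i h = phi (t + h)%R.
    by rewrite /coord_line upd_rV_add.
  have rE t : slope_right (coord_line u (upd_rV x i t) i) 0%R = slope_right phi t.
    by rewrite /slope_right; under eq_fun do rewrite !lineE add0r addr0.
  have lE t : slope_left (coord_line u (upd_rV x i t) i) 0%R = slope_left phi t.
    by rewrite /slope_left; under eq_fun do rewrite !lineE add0r addr0.
  have := countable_nonsmooth phi_gtNy phi_convex; congr (countable _).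
  by apply/seteqP; split => t /=; rewrite /smooth_coord rE lE.
- by move=> x /= /not_implyP.
Qed.

End MeasurableGradient.

(** * Measurability *)

Section Measurability.
Variable R : realType.
Local Open Scope ereal_scope.

Lemma measurable_expeR : measurable_fun setT (@expeR R).
Proof.
rewrite (_ : @expeR R = fun x => if x == -oo then 0 else
  if x == +oo then +oo else (expR (fine x))%:E); last first.
  by apply/funext; case.
apply: measurable_fun_ifT => //; first exact: measurable_fun_eqe.
apply: measurable_fun_ifT => //; first exact: measurable_fun_eqe.
by apply/measurable_EFinP; exact: measurableT_comp.
Qed.

Lemma measurable_inve_ge0 d (T : measurableType d) (F : T -> \bar R) :
  measurable_fun setT F -> (forall x, 0 <= F x) -> measurable_fun setT (fun x => (F x)^-1).
Proof.
move=> mF F0.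
(* Apart from the conventions at 0 and [+oo], inversion is the power with exponent -1. *)
rewrite (_ : (fun x => _) = fun x => if F x == 0 then +oo else
  if F x == +oo then 0 else (fine (F x) `^ (-1))%:E); last first.
  apply/funext => x; have := F0 x; case: (F x) => [r| |]//.
  rewrite lee_fin inver eqe; case: eqVneq => //= r0 r1.
  by rewrite powR_inv1.
apply: measurable_fun_ifT => //; first exact: measurable_fun_eqe.
apply: measurable_fun_ifT => //; first exact: measurable_fun_eqe.
apply/measurable_EFinP; apply: measurableT_comp (measurable_powR _) _.
exact: measurableT_comp.
Qed.

Lemma continuous_dotp n (x : 'rV[R]_n) : continuous (dotp x).
Proof.
apply: continuous_big => [|i _ y]; first exact: add_continuous.
by apply: continuousM; [exact: cst_continuous|exact: coord_continuous].
Qed.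

(** A supremum of functions each affine or constantly infinite is lower semicontinuous, whatever [w]
    is. *)
Lemma measurable_legendre n (w : 'rV[R]_n -> \bar R) :
  measurable_fun setT (legendre w : borel_rV R n -> \bar R).
Proof.
apply: lower_semicontinuous_measurable_rV => c.
rewrite (_ : [set _ | _] =
    \bigcup_x [set y : 'rV[R]_n | c%:E < (dotp x y)%:E - w x]); last first.
  apply/seteqP; split => y /=.
    by move=> /ereal_sup_gt[_ [x _ <-] cx]; exists x.
  by move=> [x _ /= cx]; rewrite (lt_le_trans cx)// ereal_sup_ubound//; exists x.
apply: bigcup_open => x _; case: (w x) => [W| |].
- rewrite (_ : [set _ | _] = dotp x @^-1` [set r | (c + W < r)%R]).
    by apply: open_comp => [y _|]; [exact: continuous_dotp|exact: open_gt].
  by apply/seteqP; split => y /=; rewrite -EFinB lte_fin ltrBrDr.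
- rewrite (_ : [set _ | _] = set0); first exact: open0.
  by apply/seteqP; split => y.
- rewrite (_ : [set _ | _] = setT); first exact: openT.
  by apply/seteqP; split => y //= _; rewrite ltry.
Qed.

Lemma legendre_ge0 n (w : 'rV[R]_n -> \bar R) y : w 0%R <= 0 -> 0 <= legendre w y.
Proof.
move=> w0; apply: (@le_trans _ _ ((dotp 0 y)%:E - w 0%R)).
  rewrite /dotp big1 ?sub0e ?oppe_ge0//.
  by move=> i _; rewrite mxE mul0r.
by apply: ereal_sup_ubound; exists 0%R.
Qed.

Lemma measurable_lp_integrand n p (u v : 'rV[R]_n -> \bar R) :
  measurable_fun setT (lp_integrand p u v : borel_rV R n -> \bar R).
Proof.
apply: emeasurable_funM.
  exact: measurableT_comp (measurable_poweR _) (measurable_legendre _).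
apply: measurable_inve_ge0 => [|x]; last exact: poweR_ge0.
exact: measurableT_comp (measurable_poweR _) (measurable_legendre _).
Qed.

Lemma lp_integrand_ge0 n p (u v : 'rV[R]_n -> \bar R) y : 0 <= lp_integrand p u v y.
Proof.
rewrite mule_ge0 ?poweR_ge0//.
by have := poweR_ge0 (legendre u y) (p - 1); case: inveP => // r; rewrite !lee_fin invr_ge0.
Qed.

End Measurability.

(** * The mass bound *)

Section Energy.
Variables (R : realType) (m : nat) (u : 'rV[R]_m.+1 -> \bar R).
Local Open Scope ereal_scope.
Local Notation n := m.+1.
Local Notation mu := (leb_rV R n).
Hypothesis uA0 : class_A0 u.

Let u_gtNy x : -oo < u x. Proof. by case: uA0 => -[[[]]]. Qed.
Let u_convex : convex_efun u. Proof. by case: uA0 => -[[_ []]]. Qed.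
Let u_ge0 x : 0 <= u x. Proof. by case: uA0 => -[_ []]. Qed.
Let u0 : u 0%R = 0. Proof. by case: uA0 => -[_ [_ []]]. Qed.
Let Ju_lty : J u < +oo. Proof. by case: uA0 => _ []. Qed.

(** [u] is its own biconjugate, hence a Legendre transform. *)
Lemma measurable_A0 : measurable_fun setT (u : borel_rV R n -> \bar R).
Proof. by case: uA0 => -[_ [_ [<- _]]] _; exact: measurable_legendre. Qed.

Let F (x : borel_rV R n) : R := fine (efun u x).
Let g := grad_right u.
Let s (x : borel_rV R n) : R := dotp x (g x).
(** The positive part of [s] agrees with [s] at smooth points of finite [u], and keeps 1 + e [sp]
    positive everywhere. *)
Let sp (x : borel_rV R n) : R := Num.max (s x) 0%R.

Lemma measurable_efun : measurable_fun setT (efun u : borel_rV R n -> \bar R).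
Proof.
apply: measurableT_comp; first exact: measurable_expeR.
by apply: measurableT_comp => //; exact: measurable_A0.
Qed.

Lemma efunE x : efun u x = (F x)%:E.
Proof.
rewrite /F /efun; have := u_ge0 x; case: (u x) => [U _|_|]//.
Qed.

Let F_ge0 x : (0 <= F x)%R.
Proof. by rewrite -lee_fin -efunE expeR_ge0. Qed.

Let mF : measurable_fun setT F.
Proof. by apply: measurableT_comp => //; exact: measurable_efun. Qed.

Let msp : measurable_fun setT sp.
Proof.
apply: measurable_funrpos; rewrite /s /dotp.
apply: measurable_sum => i; apply: measurable_funM; first exact: measurable_coord.
exact: measurableT_comp (measurable_coord i) (measurable_grad_right measurable_A0).
Qed.

Let sp_ge0 x : (0 <= sp x)%R. Proof. by rewrite le_max lexx orbT. Qed.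

Section at_smooth_point.
Variables (x : 'rV[R]_n) (U : R).
Hypotheses (uU : u x = U%:E) (sx : forall i, smooth_coord u i x).

Let sub z Z : u (x + z)%R = Z%:E -> (U + dotp z (g x) <= Z)%R.
Proof. exact: (grad_right_subgradient u_gtNy u_convex). Qed.

(** Subgradient inequality at the origin, where [u] vanishes. *)
Lemma smooth_pot_le : (U <= s x)%R.
Proof.
have := @sub (- x)%R 0%R; rewrite subrr u0 => /(_ erefl).
rewrite /dotp (eq_bigr (fun i => - (x 0 i * g x 0 i))%R) ?sumrN ?subr_le0//.
by move=> i _; rewrite mxE mulNr.
Qed.

Lemma smooth_sp : sp x = s x.
Proof.
apply/max_idPl; apply: le_trans smooth_pot_le.
by rewrite -lee_fin -uU.
Qed.

Lemma smooth_dilate (e : R) : (U + e * s x)%:E <= u ((1 + e) *: x)%R.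
Proof.
have := u_gtNy ((1 + e) *: x)%R; case uZ : (u _) => [Z| |]// _; last by rewrite leey.
move: uZ; rewrite scalerDl scale1r lee_fin => /sub; rewrite /dotp.
by under eq_bigr do rewrite mxE -mulrA; rewrite -mulr_sumr.
Qed.

(** Equality in Fenchel's inequality: a subgradient at [x] makes [x] attain the supremum. *)
Lemma smooth_legendre : legendre u (g x) = (s x - U)%:E.
Proof.
apply/eqP; rewrite eq_le; apply/andP; split; last first.
  by apply: ereal_sup_ubound; exists x => //; rewrite uU.
apply: ge_ereal_sup => _ [y _ <-]; have := u_gtNy y.
case uY : (u y) => [Y| |]// _; last by rewrite leNye.
rewrite -EFinB lee_fin.
have := @sub (y - x)%R Y; rewrite addrC subrK => /(_ uY).
rewrite /s /dotp (eq_bigr (fun i => y 0 i * g x 0 i - x 0 i * g x 0 i)%R).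
  by rewrite sumrB; lra.
by move=> i _; rewrite !mxE mulrBl.
Qed.

End at_smooth_point.

Let fin_pot x : u x < +oo -> exists U, u x = U%:E.
Proof. by have := u_gtNy x; case: (u x) => // U _ _; exists U. Qed.

Let J_int : J u = \int[mu]_x (F x)%:E.
Proof.
rewrite /J (int_Rn_ge0 (G := efun u)) ?measurable_efun//.
- by apply: eq_integral => x _; rewrite efunE.
- exact: measurable_efun.
- by move=> x; exact: expeR_ge0.
- exact: aeW.
Qed.

(** The induction step uses (1+e)(1-(k+1)e) <= 1-ke. The product form also covers negative 1-ke. *)
Lemma bernoulli_inv (e : R) k : (0 <= e)%R -> ((1 + e) ^+ k * (1 - k%:R * e) <= 1)%R.
Proof.
move=> e0; elim: k => [|k IH]; first by rewrite mul0r subr0 mulr1 expr0.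
apply: le_trans IH; rewrite exprSr -mulrA ler_wpM2l//.
  by rewrite exprn_ge0//; lra.
rewrite -natr1; have : (0 <= k%:R :> R)%R by [].
move: (k%:R)%R => K K0; nra.
Qed.

(** With [A] = F/(1 + e sp) one has F = [A] + e [damp]; as e decreases to 0, [damp] increases to F
    sp. *)
Let damp (e : R) x := (F x * (sp x / (1 + e * sp x)))%R.

Lemma integral_damp_le (e : R) : (0 < e)%R ->
  \int[mu]_x (damp e x)%:E <= n%:R%:E * J u.
Proof.
move=> e0.
have D0 x : (0 < 1 + e * sp x)%R by rewrite ltr_wpDr// mulr_ge0// ltW.
pose A x := (F x / (1 + e * sp x))%R.
have mD : measurable_fun setT (fun x => (1 + e * sp x)^-1)%R.
  rewrite (_ : (fun x => _) = (fun x => (1 + e * sp x) `^ (-1))%R).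
    apply: measurableT_comp (measurable_powR _) _.
    by apply: measurable_funD => //; exact: measurable_funM.
  by apply/funext => x; rewrite powR_inv1// ltW.
have mA : measurable_fun setT A by exact: measurable_funM.
have mC : measurable_fun setT (damp e) by do 2 apply: measurable_funM => //.
have A0 x : (0 <= A x)%R by rewrite divr_ge0// ltW.
have C0 x : (0 <= damp e x)%R by rewrite mulr_ge0// divr_ge0// ltW.
have FAC : \int[mu]_x (F x)%:E = \int[mu]_x (A x)%:E + e%:E * \int[mu]_x (damp e x)%:E.
  rewrite -ge0_integralZl//; last 3 first.
  - exact/measurable_EFinP.
  - by move=> x _; rewrite lee_fin.
  - by rewrite lee_fin ltW.
  rewrite -ge0_integralD//; last 4 first.
  - by move=> x _; rewrite lee_fin.
  - exact/measurable_EFinP.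
  - by move=> x _; rewrite -EFinM lee_fin mulr_ge0// ltW.
  - by apply: emeasurable_funM => //; exact/measurable_EFinP.
  apply: eq_integral => x _; rewrite -EFinM -EFinD; congr (_%:E).
  rewrite /A /damp; field; exact: lt0r_neq0.
(* Substitute (1+e)x; then F((1+e)x) <= A(x) by the subgradient inequality and exp(r) >= 1 + r. *)
have scaleA : \int[mu]_x (F x)%:E <= ((1 + e) ^+ n)%:E * \int[mu]_x (A x)%:E.
  have e1 : (0 < 1 + e)%R by lra.
  rewrite -[leLHS](ge0_integral_leb_rV_scale e1); last 2 first.
  - exact/measurable_EFinP.
  - by move=> x; rewrite lee_fin.
  apply: lee_wpmul2l; first by rewrite lee_fin exprn_ge0// ltW.
  have mFe : measurable_fun setT (fun x : borel_rV R n => (F ((1 + e) *: (x : 'rV_n))%R)%:E).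
    apply/measurable_EFinP; apply: measurableT_comp mF _.
    apply: measurable_fun_rV => j; under eq_fun do rewrite mxE.
    by apply: measurable_funM => //; exact: measurable_coord.
  apply: ae_ge0_le_integral => //.
  - by move=> x _; rewrite lee_fin.
  - by move=> x _; rewrite lee_fin.
  - exact/measurable_EFinP.
  apply: aeS (ae_smooth measurable_A0 u_gtNy u_convex) => x sx _.
  rewrite -efunE.
  (* If [u x] is infinite, so is [u] at (1+e)x: otherwise convexity on the segment from 0 would make
     [u x] finite. *)
  have [/[dup] /fin_pot[U uU] /sx {}sx|] := ltP (u x) +oo; last first.
    rewrite leye_eq => /eqP ux.
    suff ue : u ((1 + e) *: x)%R = +oo by rewrite /efun ue /= lee_fin.
    have := u_gtNy ((1 + e) *: x)%R; case uZ : (u _) => [Z| |]// _.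
    have l01 : (0 <= (1 + e)^-1 <= 1)%R by rewrite invr_ge0 ltW//= invf_le1//; lra.
    have [W + _] := convex_fin u_gtNy u_convex l01 u0 uZ.
    by rewrite scaler0 add0r scalerA mulVf ?gt_eqF// scale1r ux.
  have := smooth_dilate uU sx e; rewrite -(smooth_sp uU sx) => ue.
  apply: (@le_trans _ _ (expeR (- (U + e * sp x)%:E))).
    by rewrite /efun lee_expeR leeN2.
  rewrite /= lee_fin /A /F /efun uU /= opprD expRD ler_wpM2l ?expR_ge0//.
  rewrite expRN lef_pV2 ?posrE ?expR_gt0//.
  exact: expR_ge1Dx.
have IA0 : 0 <= \int[mu]_x (A x)%:E by apply: integral_ge0 => x _; rewrite lee_fin.
have IC0 : 0 <= \int[mu]_x (damp e x)%:E.
  by apply: integral_ge0 => x _; rewrite lee_fin.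
(* Three numbers remain: j = a + ec is finite and j <= (1+e)^n a; the claim is c <= nj. An infinite
   c would make j infinite. *)
move: FAC scaleA IA0 IC0 Ju_lty; rewrite J_int.
move: (\int[mu]_x (F x)%:E) (\int[mu]_x (A x)%:E) (\int[mu]_x (damp e x)%:E) => j a c.
case: c => [c| |]//; last first.
  by rewrite gt0_muley ?lte_fin//; case: a => [a| |]// ->.
case: a => [a| |]//; last by move=> ->.
rewrite -EFinM -EFinD => -> + + + _; rewrite -!EFinM !lee_fin => le_a a0 c0.
have := bernoulli_inv n (ltW e0); move: (_ ^+ _)%R le_a => L le_a LB.
suff : (e * c <= e * (n%:R * (a + e * c)))%R by rewrite ler_pM2l.
move: LB; move: (n%:R)%R => N LB.
(* Multiplying by 1-Ne needs Ne <= 1; otherwise ec <= a + ec already gives the bound. *)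
have [Ne|Ne] := lerP (N * e) 1.
  have := ler_wpM2r (_ : 0 <= 1 - N * e)%R le_a.
  rewrite subr_ge0 => /(_ Ne); have := ler_wpM2r a0 LB; nra.
have ec0 : (0 <= e * c)%R by rewrite mulr_ge0// ltW.
rewrite mulrA [(e * N)%R]mulrC; apply: (@le_trans _ _ (1 * (a + e * c)))%R; first lra.
by rewrite ler_wpM2r ?addr_ge0// ltW.
Qed.

(** Monotone convergence along e = 1/(k+1). *)
Lemma integral_dot_le : \int[mu]_x (F x * sp x)%:E <= n%:R%:E * J u.
Proof.
pose C (k : nat) (x : borel_rV R n) := (damp k.+1%:R^-1 x)%:E.
have mC k : measurable_fun setT (C k).
  apply/measurable_EFinP; apply: measurable_funM => //; apply: measurable_funM => //.
  rewrite (_ : (fun x => _) = (fun x => (1 + k.+1%:R^-1 * sp x) `^ (-1))%R).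
    apply: measurableT_comp (measurable_powR _) _.
    by apply: measurable_funD => //; exact: measurable_funM.
  by apply/funext => x; rewrite powR_inv1// addr_ge0// mulr_ge0.
have C0 k x : 0 <= C k x.
  by rewrite lee_fin mulr_ge0// divr_ge0// addr_ge0// mulr_ge0.
have D0 k x : (0 < 1 + k.+1%:R^-1 * sp x)%R by rewrite ltr_wpDr// mulr_ge0.
have ndC x : nondecreasing_seq (C ^~ x).
  move=> k l kl; rewrite /C lee_fin ler_wpM2l// ler_wpM2l// lef_pV2 ?posrE//.
  by rewrite lerD2l ler_wpM2r// lef_pV2 ?posrE ?ltr0n// ler_nat.
have limC x : limn (C ^~ x) = (F x * sp x)%:E.
  apply/cvg_lim => //; apply: cvg_EFin; first exact: nearW.
  rewrite [X in _ --> X](_ : _ = F x * (sp x / (1 + 0 * sp x)))%R; last first.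
    by rewrite mul0r addr0 divr1.
  apply: cvgM; first exact: cvg_cst.
  apply: cvgM; first exact: cvg_cst.
  apply: cvgV; first by rewrite mul0r addr0 oner_eq0.
  apply: cvgD; first exact: cvg_cst.
  apply: cvgM; last exact: cvg_cst.
  exact: cvg_harmonic.
under eq_integral do rewrite -limC.
rewrite (monotone_convergence _ measurableT mC) => [|k x _|x _]; [|exact: C0|exact: ndC].
apply: lime_le.
  apply: ereal_nondecreasing_is_cvgn => k l kl.
  by apply: ge0_le_integral => // x _; exact: ndC.
by apply: nearW => k; apply: integral_damp_le; rewrite invr_gt0.
Qed.



(** Fenchel's equality times the density; where [u] is infinite the density is 0 and every product
    vanishes. *)
Lemma ae_legendre_split : \forall x \ae mu,
  legendre u (g x) * efun u x + u x * efun u x = (F x * sp x)%:E.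
Proof.
apply: aeS (ae_smooth measurable_A0 u_gtNy u_convex) => x sx.
have [/[dup] /fin_pot[U uU] /sx {}sx|] := ltP (u x) +oo; last first.
  by rewrite leye_eq => /eqP ux; rewrite /F /efun ux /= !mule0 adde0 mul0r.
rewrite efunE (smooth_legendre uU sx) (smooth_sp uU sx) uU -!EFinM -EFinD.
by rewrite -mulrDl subrK mulrC.
Qed.

Let H x := legendre u (g x) * efun u x.
Let P x := u x * efun u x.

Let H_ge0 x : 0 <= H x.
Proof. by rewrite mule_ge0 ?expeR_ge0// legendre_ge0// u0. Qed.

Let P_ge0 x : 0 <= P x.
Proof. by rewrite mule_ge0 ?expeR_ge0. Qed.

Lemma measurable_legendre_grad :
  measurable_fun setT (fun x : borel_rV R n => legendre u (g x)).
Proof.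
exact: measurableT_comp (measurable_legendre u) (measurable_grad_right measurable_A0).
Qed.

Let mH : measurable_fun setT (H : borel_rV R n -> \bar R).
Proof. by apply: emeasurable_funM; [exact: measurable_legendre_grad|exact: measurable_efun]. Qed.

Let mP : measurable_fun setT (P : borel_rV R n -> \bar R).
Proof. by apply: emeasurable_funM; [exact: measurable_A0|exact: measurable_efun]. Qed.

(** The integrals of [H] and [P] add up to at most n J(f), while [Jdiamond u] is n J(f) minus the
    integral of [P]. The latter is finite, so it can be subtracted. *)
Lemma integral_legendre_grad_le : exists2 c : R, Jdiamond u = c%:E &
  \int[mu]_x (legendre u (grad_right u x) * efun u x) <= c%:E.
Proof.
have HP : \int[mu]_x H x + \int[mu]_x P x <= n%:R%:E * J u.
  rewrite -ge0_integralD//.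
  by rewrite (ae_eq_integralT ae_legendre_split) integral_dot_le.
have IF0 : 0 <= \int[mu]_x (F x)%:E by apply: integral_ge0 => x _; rewrite lee_fin.
have IH0 : 0 <= \int[mu]_x H x by exact: integral_ge0.
have IP0 : 0 <= \int[mu]_x P x by exact: integral_ge0.
have iF : mu.-integrable setT (EFin \o F).
  apply/integrableP; split; first exact/measurable_EFinP.
  under eq_integral do rewrite gee0_abs ?lee_fin//.
  by rewrite -J_int.
have JF : \int[mu]_x (F x)%:E < +oo by rewrite -J_int.
have P_lty : \int[mu]_x P x < +oo.
  apply: (@le_lt_trans _ _ (n%:R%:E * J u)).
    by apply: le_trans HP; rewrite leeDr.
  by rewrite J_int lte_mul_pinfty// ?lee_fin.
have iP : mu.-integrable setT P.
  by apply/integrableP; split => //; under eq_integral do rewrite gee0_abs//.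
have JdE : Jdiamond u = n%:R%:E * J u - \int[mu]_x P x.
  rewrite /Jdiamond (_ : (fun x => _) = (fun x => n%:R%:E * (F x)%:E - P x)); last first.
    by apply/funext => x; rewrite efunE /P efunE muleN [u x * _]muleC.
  have iNF : mu.-integrable setT (fun x => n%:R%:E * (F x)%:E) by exact: integrableZl.
  rewrite int_Rn_integrable; last exact: integrableB.
  by rewrite integralB// integralZl// J_int.
move: HP JdE IF0 IH0 IP0 JF P_lty; rewrite J_int.
move: (\int[mu]_x (F x)%:E) (\int[mu]_x P x) (\int[mu]_x H x) => [j| |]// [k| |]// h.
rewrite -EFinM => HP JdE _ h0 k0 _ _.
by exists (n%:R * j - k)%R; rewrite ?JdE// EFinB leeBrDr.
Qed.

(** The two fields agree at almost every point of finite [u]; elsewhere the density vanishes. *)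
Lemma int_Rn_lp_integrand p (v : 'rV[R]_n -> \bar R) :
  int_Rn (fun x => lp_integrand p u v (grad u x) * efun u x) =
  \int[mu]_x (lp_integrand p u v (grad_right u x) * efun u x).
Proof.
apply: int_Rn_ge0.
- apply: emeasurable_funM; last exact: measurable_efun.
  exact: measurableT_comp (measurable_lp_integrand _ _ _) (measurable_grad_right measurable_A0).
- by move=> x; rewrite mule_ge0 ?lp_integrand_ge0 ?expeR_ge0.
apply: aeS (ae_smooth measurable_A0 u_gtNy u_convex) => x sx.
have [ux|] := ltP (u x) +oo; first by rewrite (grad_smooth u_gtNy u_convex ux (sx ux)).
by rewrite leye_eq => /eqP ux; rewrite /efun ux /= !mule0.
Qed.

End Energy.

(** * Monotonicity in the exponent *)

Section Comparison.
Variable R : realType.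
Local Open Scope ereal_scope.

(** After division by [b] this is t^p <= (p/q) t^q + (1 - p/q) for t = a/b: Young's inequality for
    t^p and 1 with conjugate exponents q/p and 1/(1 - p/q). *)
Lemma powR_young (a b p q : R) : (0 <= a)%R -> (0 < b)%R -> (1 <= p)%R -> (p < q)%R ->
  (a `^ p * (b `^ (p - 1))^-1 <=
    p / q * (a `^ q * (b `^ (q - 1))^-1) + (1 - p / q) * b)%R.
Proof.
move=> a0 b0 p1 pq.
have p0 : (0 < p)%R by lra.
have q0 : (0 < q)%R by lra.
have t0 : (0 <= a / b)%R by rewrite divr_ge0// ltW.
have pow_ratio r : (a `^ r * (b `^ (r - 1))^-1 = (a / b) `^ r * b)%R.
  rewrite -[in LHS](divfK (lt0r_neq0 b0) a); move: (a / b)%R t0 => t t0.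
  rewrite powRM ?(ltW b0)// -mulrA; congr (_ * _)%R.
  have -> : (b `^ r = b `^ (r - 1) * b)%R.
    rewrite -[in LHS](subrK 1%R r) [in LHS]powRD ?(powRr1 (ltW b0))//.
    by rewrite (gt_eqF b0) implybT.
  by rewrite mulrAC divff ?mul1r// gt_eqF// powR_gt0.
rewrite !pow_ratio mulrA -mulrDl ler_pM2r//.
have th0 : (0 < 1 - p / q)%R by rewrite subr_gt0 ltr_pdivrMr// mul1r.
have := @conjugate_powR R ((a / b) `^ p)%R 1%R (q / p)%R (1 - p / q)^-1%R
  (powR_ge0 _ _) ler01 (divr_gt0 q0 p0).
rewrite invr_gt0 invrK invf_div => /(_ th0).
rewrite addrC subrK => /(_ erefl).
rewrite mulr1 powR1 mul1r -powRrM.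
by rewrite [(p * (q / p))%R]mulrC divfK ?gt_eqF// [(_ * (p / q))%R]mulrC.
Qed.

(* With [0^-1 = +oo] and [+oo^-1 = 0] in [\bar R], the right-hand side is [+oo]
   when [b = +oo], and when [b = 0] unless [a = 0]. *)
Lemma poweR_young (a b : \bar R) (p q : R) : 0 <= a -> 0 <= b -> (1 <= p)%R -> (p < q)%R ->
  a `^ p * (b `^ (p - 1))^-1 <=
    (p / q)%:E * (a `^ q * (b `^ (q - 1))^-1) + (1 - p / q)%:E * b.
Proof.
move=> a0 b0 p1 pq.
have p0 : (0 < p)%R by lra.
have q0 : (0 < q)%R by lra.
have th0 : (0 < p / q)%R by rewrite divr_gt0.
have th1 : (0 < 1 - p / q)%R by rewrite subr_gt0 ltr_pdivrMr// mul1r.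
have inv_ge0 (x : \bar R) : 0 <= x -> 0 <= x^-1.
  by case: inveP => // r; rewrite !lee_fin invr_ge0.
have ab0 r : 0 <= a `^ r * (b `^ (r - 1))^-1.
  by rewrite mule_ge0 ?poweR_ge0// inv_ge0// poweR_ge0.
have thab0 : 0 <= (p / q)%:E * (a `^ q * (b `^ (q - 1))^-1).
  by rewrite mule_ge0// lee_fin ltW.
have [b_oo|b_oo] := eqVneq b +oo.
  by rewrite {3}b_oo gt0_muley ?lte_fin// addey ?leey// -ltNye (lt_le_trans _ thab0).
have [a_0|a_0] := eqVneq a 0.
  apply: (@le_trans _ _ 0); first by rewrite a_0 (poweR0r (lt0r_neq0 p0)) mul0e.
  by rewrite adde_ge0// mule_ge0// lee_fin ltW.
have [->|b_0] := eqVneq b 0.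
  rewrite [in X in _ <= X]poweR0r ?subr_eq0 ?gt_eqF//; last lra.
  by rewrite inve0 gt0_muley ?poweR_gt0 ?lt0e ?a_0// gt0_muley ?lte_fin// mule0 adde0 leey.
case: b b0 b_oo b_0 inv_ge0 ab0 thab0 => [b| |]// b0 _ b_0 _ _ _.
have {b0 b_0} b0 : (0 < b)%R by rewrite lt0r -eqe b_0.
have bE r : ((b%:E `^ r)^-1 = ((b `^ r)^-1)%:E).
  by rewrite poweR_EFin inver gt_eqF// powR_gt0.
rewrite !bE; case: a a0 a_0 => [a a0 _|_ _|//].
  by rewrite !poweR_EFin -!EFinM -EFinD lee_fin powR_young.
rewrite (poweRyr (lt0r_neq0 q0)) gt0_mulye ?lte_fin ?invr_gt0 ?powR_gt0//.
by rewrite gt0_muley ?lte_fin// addye ?leey.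
Qed.

(** The ratio bound forces a = 0 when b = 0, and [a] finite when [b] is finite; in the remaining
    finite case a^q <= b^q. *)
Lemma poweR_le_ratio (a b : \bar R) (q : R) : 0 <= a -> 0 <= b -> (1 <= q)%R ->
  a * b^-1 <= 1 -> a `^ q * (b `^ (q - 1))^-1 <= b.
Proof.
move=> a0 b0 q1; have q0 : (0 < q)%R by lra.
have [->|b_oo] := eqVneq b +oo; first by rewrite leey.
have [->|a_0] := eqVneq a 0; first by rewrite (poweR0r (lt0r_neq0 q0)) !mul0e.
have [->|b_0] := eqVneq b 0; first by rewrite inve0 gt0_muley ?lt0e ?a_0// leye_eq.
case: b b0 b_oo b_0 => [b| |]// b0 _ b_0.
have {b0 b_0} b0 : (0 < b)%R by rewrite lt0r -eqe b_0.
rewrite poweR_EFin !inver !gt_eqF ?powR_gt0//.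
case: a a0 a_0 => [a a0 _|_ _|//]; last by rewrite gt0_mulye ?lte_fin ?invr_gt0// leye_eq.
rewrite poweR_EFin -!EFinM !lee_fin !ler_pdivrMr ?powR_gt0// mul1r => ab.
apply: (@le_trans _ _ (b `^ q)%R).
  by rewrite ge0_ler_powR ?nnegrE// ltW.
by rewrite mulr_powRB1// ltW.
Qed.

(** Taking roots preserves comparison with 1. For c = 0 the factor is [+oo], so both sides say I =
    0. *)
Lemma poweR_mean_le1 (c q : R) (I : \bar R) : (0 <= c)%R -> 0 <= I -> (0 < q)%R ->
  ((c%:E^-1 * I) `^ q^-1 <= 1) = (I <= c%:E).
Proof.
move=> c0 I0 q0.
have inv0 : 0 <= c%:E^-1 by rewrite inver; case: ifP => // _; rewrite lee_fin invr_ge0.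
have X0 : 0 <= c%:E^-1 * I by exact: mule_ge0.
have -> : ((c%:E^-1 * I) `^ q^-1 <= 1) = (c%:E^-1 * I <= 1).
  apply/idP/idP => X1.
    have XE : c%:E^-1 * I = ((c%:E^-1 * I) `^ q^-1) `^ q.
      by rewrite -poweRrM mulVf ?gt_eqF// poweRe1.
    rewrite XE -[leRHS](poweR1r q).
    apply: gt0_ler_poweR => //; first exact: ltW.
      by rewrite in_itv/= poweR_ge0 leey.
    by rewrite in_itv/= lee01 leey.
  rewrite -[leRHS](poweR1r q^-1).
  apply: gt0_ler_poweR => //; first by rewrite invr_ge0 ltW.
    by rewrite in_itv/= X0 leey.
  by rewrite in_itv/= lee01 leey.
have [c_0|c_0] := eqVneq c 0%R.
  rewrite c_0 inve0; have [->|I_0] := eqVneq I 0; first by rewrite mule0 lee01 lexx.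
  rewrite gt0_mulye ?lt0e ?I_0//; apply/esym; apply/negbTE.
  by rewrite -ltNge lt0e I_0.
have {}c0 : (0 < c)%R by rewrite lt0r c_0.
by rewrite inver (negPf c_0) lee_pdivrMl// mule1.
Qed.

End Comparison.

(** * Inclusions between the constraint sets *)

Section Monotonicity.
Variables (R : realType) (m : nat) (u v : 'rV[R]_m.+1 -> \bar R).
Local Open Scope ereal_scope.
Local Notation n := m.+1.
Local Notation mu := (leb_rV R n).
Hypotheses (uA0 : class_A0 u) (v0 : v 0%R <= 0).

Let u0 : u 0%R <= 0. Proof. by case: uA0 => -[_ [_ [_ ->]]]. Qed.

Let I p := \int[mu]_x (lp_integrand p u v (grad_right u x) * efun u x).
Let B := \int[mu]_x (legendre u (grad_right u x) * efun u x).

Let mI p : measurable_fun setT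
  (fun x : borel_rV R n => lp_integrand p u v (grad_right u x) * efun u x).
Proof.
apply: emeasurable_funM; last exact: measurable_efun.
exact: measurableT_comp (measurable_lp_integrand _ _ _)
  (measurable_grad_right (measurable_A0 uA0)).
Qed.

Let mB : measurable_fun setT
  (fun x : borel_rV R n => legendre u (grad_right u x) * efun u x).
Proof.
by apply: emeasurable_funM; [exact: measurable_legendre_grad|exact: measurable_efun].
Qed.

Let ge0I p x : 0 <= lp_integrand p u v (grad_right u x) * efun u x.
Proof. by rewrite mule_ge0 ?lp_integrand_ge0 ?expeR_ge0. Qed.

Let ge0B x : 0 <= legendre u (grad_right u x) * efun u x.
Proof. by rewrite mule_ge0 ?legendre_ge0 ?expeR_ge0. Qed.

Let deltaJp_le1E p c : (0 < p)%R -> (0 <= c)%R -> Jdiamond u = c%:E ->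
  (deltaJp p u v <= 1) = (I p <= c%:E).
Proof.
move=> p0 c0 Jc; rewrite /deltaJp Jc int_Rn_lp_integrand// poweR_mean_le1//.
exact: integral_ge0.
Qed.

Let mass_bound : exists c : R, [/\ Jdiamond u = c%:E, B <= c%:E & (0 <= c)%R].
Proof.
have [c Jc Bc] := integral_legendre_grad_le uA0; exists c; split => //.
by rewrite -lee_fin; apply: le_trans Bc; exact: integral_ge0.
Qed.

(** Integrating Young's inequality bounds [I p] by the convex combination of [I q] and [B] with
    weights p/q and 1 - p/q; both are at most [c], one by the constraint, the other by the mass
    bound. *)
Lemma deltaJp_le1_mono p q : (1 <= p)%R -> (p <= q)%R ->
  deltaJp q u v <= 1 -> deltaJp p u v <= 1.
Proof.
move=> p1; rewrite le_eqVlt => /predU1P[->//|pq].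
have p0 : (0 < p)%R by lra.
have q0 : (0 < q)%R by lra.
have [c [Jc Bc c0]] := mass_bound.
rewrite (deltaJp_le1E q0 c0 Jc) (deltaJp_le1E p0 c0 Jc) => Iq.
have th0 : (0 <= p / q)%R by rewrite divr_ge0// ltW.
have th1 : (0 <= 1 - p / q)%R by rewrite subr_ge0 ler_pdivrMr// mul1r ltW.
apply: (@le_trans _ _ ((p / q)%:E * I q + (1 - p / q)%:E * B)).
  rewrite -!ge0_integralZl//; try by [move=> x _; exact: ge0I|move=> x _; exact: ge0B].
  rewrite -ge0_integralD//; first last.
  - by apply: emeasurable_funM => //; exact: mB.
  - by move=> x _; rewrite mule_ge0// lee_fin.
  - by apply: emeasurable_funM => //; exact: mI.
  - by move=> x _; rewrite mule_ge0// lee_fin.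
  apply: ge0_le_integral => //.
    apply: emeasurable_funD; apply: emeasurable_funM => //.
  move=> x _; have f0 : 0 <= efun u x by exact: expeR_ge0.
  rewrite [(p / q)%:E * _]muleA [(1 - p / q)%:E * _]muleA -ge0_muleDl; last 2 first.
  - by rewrite mule_ge0 ?lee_fin// lp_integrand_ge0.
  - by rewrite mule_ge0 ?lee_fin// legendre_ge0.
  by rewrite lee_wpmul2r// poweR_young// legendre_ge0.
apply: (@le_trans _ _ ((p / q)%:E * c%:E + (1 - p / q)%:E * c%:E)).
  by apply: leeD; apply: lee_wpmul2l; rewrite ?lee_fin.
by rewrite -!EFinM -EFinD lee_fin -mulrDl addrC subrK mul1r.
Qed.

(** The integrand of [I q] is pointwise at most that of [B]. *)
Lemma deltaJinf_le1 q : (1 <= q)%R -> deltaJinf u v <= 1 -> deltaJp q u v <= 1.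
Proof.
move=> q1 infle; have q0 : (0 < q)%R by lra.
have [c [Jc Bc c0]] := mass_bound.
rewrite (deltaJp_le1E q0 c0 Jc); apply: le_trans Bc.
apply: ge0_le_integral => // x _; rewrite lee_wpmul2r ?expeR_ge0//.
apply: poweR_le_ratio => //; try exact: legendre_ge0.
by apply: le_trans infle; apply: ereal_sup_ubound; exists (grad_right u x).
Qed.

End Monotonicity.

Theorem theorem4p5 (R : realType) (n : nat) (u : 'rV[R]_n -> \bar R)
  (p q : R) (phi_inf phi_q phi_p phi_1 : 'M[R]_n) :
  (0 < n)%N -> class_A0 u -> 1 <= p -> p <= q ->
  is_LinfJohn u phi_inf -> is_LpJohn q u phi_q ->
  is_LpJohn p u phi_p -> is_LpJohn 1 u phi_1 ->
  [/\ (J (gauss_pot phi_inf) <= J (gauss_pot phi_q))%E,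
      (J (gauss_pot phi_q) <= J (gauss_pot phi_p))%E &
      (J (gauss_pot phi_p) <= J (gauss_pot phi_1))%E].
Proof.
case: n u phi_inf phi_q phi_p phi_1 => [|m] u phi_inf phi_q phi_p phi_1 n0.
  by exfalso; rewrite ltnn in n0.
move=> uA0 p1 pq {n0}.
move=> [unit_inf [inf_le1 _]] [unit_q [q_le1 max_q]] [unit_p [p_le1 max_p]] [_ [_ max_1]].
(* Vanishing at 0 makes the Legendre transform of a Gaussian potential nonnegative. *)
have gauss0 (phi : 'M[R]_m.+1) : (gauss_pot phi 0 <= 0)%E.
  by rewrite /gauss_pot mul0mx /sqnorm big1 ?mul0r// => i _; rewrite mxE expr0n.
(* Each time, the maximizer for the larger exponent is a competitor for the smaller one. *)
split.
- exact: (max_q _ unit_inf (deltaJinf_le1 uA0 (gauss0 _) (le_trans p1 pq) inf_le1)).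
- exact: (max_p _ unit_q (deltaJp_le1_mono uA0 (gauss0 _) p1 pq q_le1)).
- exact: (max_1 _ unit_p (deltaJp_le1_mono uA0 (gauss0 _) (lexx 1) p1 p_le1)).
Qed.
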